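(* Let $0<\beta<d$. Let $f\in W^{1,1}_{loc}(\mathbb{R}^d)$ be radial, let $x\in\mathbb{R}^d\setminus\{0\}$ be a point at which $M_\beta f$ and $\widetilde M_\beta f$ are differentiable, and let $B=B(x,r)\in\mathcal{B}_x^\beta$ and $\widetilde B\in\widetilde{\mathcal{B}}_x^\beta$, where $\widetilde r$ denotes the radius of $\widetilde B$. i) If $\nabla M_\beta f(x)\cdot x\le 0$, then $$\left|\frac{1}{|B|}\int_{B}\nabla|f|(y)\,dy\right|\le \frac{1}{|B|}\int_{B}\big|\nabla|f|(y)\big|\,\frac{|y|}{|x|}\,dy.$$ ii) If $\nabla M_\beta f(x)\cdot x>0$, then $$|\nabla M_\beta f(x)|\le \frac{r^\beta}{|B|}\int_{B}\nabla|f|(y)\cdot\frac{y}{|x|}\,dy-\frac{\widetilde r^{\,\beta}}{|\widetilde B|}\int_{\widetilde B}\nabla|f|(y)\cdot\frac{y}{|x|}\,dy+\nabla\widetilde M_\beta f(x)\cdot\frac{x}{|x|}.$$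
   Context: For $f\in L^1_{loc}(\mathbb{R}^d)$ and $x\in\mathbb{R}^d$, the centered and non-centered fractional maximal functions are $$M_\beta f(x)=\sup_{r\ge0}\frac{r^\beta}{|B(x,r)|}\int_{B(x,r)}|f|,\qquad \widetilde M_\beta f(x)=\sup_{B(z,r)\ni x}\frac{r^\beta}{|B(z,r)|}\int_{B(z,r)}|f|,$$ the second supremum being over all balls containing $x$ ($r=0$ is understood as a limiting case, contributing $0$ since $\beta>0$). The families of good balls (of positive radius) at $x$ are $$\mathcal{B}_x^\beta=\Big\{B(x,r):\ M_\beta f(x)=\frac{r^\beta}{|B(x,r)|}\int_{B(x,r)}|f|\Big\},$$ $$\widetilde{\mathcal{B}}_x^\beta=\Big\{B(z,r):\ x\in\overline{B}(z,r),\ \widetilde M_\beta f(x)=\frac{r^\beta}{|B(z,r)|}\int_{B(z,r)}|f|\Big\}.$$ $\nabla|f|$ is the weak gradient of $|f|$. *)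

(* Defs.v *)
From HB Require Import structures.
From mathcomp Require Import all_boot all_order all_algebra.
From mathcomp Require Import all_classical all_reals all_analysis.
From mathcomp Require Import measurable_realfun.

Set Implicit Arguments.
Unset Strict Implicit.
Unset Printing Implicit Defensive.

Import Order.TTheory GRing.Theory Num.Theory.
Import numFieldNormedType.Exports.

Local Open Scope classical_set_scope.
Local Open Scope ring_scope.

(* R^d is 'rV[R]_d. The norm that the library puts on it is the sup norm; it
   only enters through the topology and through [differentiable], neither of
   which depends on the choice of a norm. The Euclidean norm is [enorm]. *)

Definition dotp (R : realType) (d : nat) (u v : 'rV[R]_d) : R :=
  \sum_(i < d) u 0 i * v 0 i.

Definition enorm (R : realType) (d : nat) (u : 'rV[R]_d) : R :=
  Num.sqrt (dotp u u).

Definition eball (R : realType) (d : nat) (z : 'rV[R]_d) (r : R) :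
  set 'rV[R]_d := [set y | enorm (y - z) < r].

Definition closed_eball (R : realType) (d : nat) (z : 'rV[R]_d) (r : R) :
  set 'rV[R]_d := [set y | enorm (y - z) <= r].

Definition borel_display : measure_display.
Proof. exact: default_measure_display. Qed.

HB.instance Definition _ (R : realType) (m n : nat) :=
  @isMeasurable.Build borel_display 'M[R]_(m, n)
    <<s @open 'M[R]_(m, n) >>
    (@sigma_algebra0 _ setT _) (@sigma_algebraC _ _)
    (@sigma_algebra_bigcup _ setT _).

Section rV_lebesgue.
Context (R : realType).

Lemma open_measurable_rV n (U : set 'rV[R]_n) : open U -> measurable U.
Proof. exact: sub_sigma_algebra. Qed.

Lemma continuous_measurable_rV n (f : 'rV[R]_n -> R) :
  continuous f -> measurable_fun [set: 'rV[R]_n] f.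
Proof.
move=> cf; apply: (measurability _ (RGenOpens.measurableE R)).
move=> _ [_ [a [b ->] <-]]; rewrite setTI; apply: open_measurable_rV.
by move/continuousP: cf; apply; exact: interval_open.
Qed.

Lemma open_measurable_prod_rV n (U : set (R * 'rV[R]_n)) :
  open U -> measurable U.
Proof.
move=> oU.
pose e (k : nat) : R := k.+1%:R^-1.
pose c (q : rat * 'rV[rat]_n) : R * 'rV[R]_n :=
  (ratr q.1, map_mx ratr q.2).
pose box (t : rat * 'rV[rat]_n * nat) : set (R * 'rV[R]_n) :=
  ball (c t.1).1 (e t.2) `*` ball (c t.1).2 (e t.2).
pose I : set (rat * 'rV[rat]_n * nat) := [set t | box t `<=` U].
have -> : U = \bigcup_(t in I) box t.
  apply/seteqP; split => [[x v] Uxv|p [t It /It//]].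
  have /nbhs_ballP[r /= r0 rU] : nbhs (x, v) U by exact: open_nbhs_nbhs.
  have [k ek] : exists k, e k < r / 2.
    by have [k _ /(_ k (leqnn k))/=] := near_infty_natSinv_lt
      (PosNum (divr_gt0 r0 (ltr0n R 2))); exists k.
  have e0 : 0 < e k by rewrite invr_gt0 ltr0n.
  have rtl (a : R) : {q : rat | ball (ratr q : R) (e k) a}.
    apply: cid; have [|q] := @rat_in_itvoo R (a - e k) (a + e k).
      by rewrite ltrBlDr -addrA ltrDl addr_gt0.
    by rewrite in_itv/= => qa; exists q; rewrite /ball/= ltr_distl.
  pose q : rat * 'rV[rat]_n :=
    (sval (rtl x), \row_i sval (rtl (v 0 i))).
  have qxv : box (q, k) (x, v).
    split; rewrite /=; first exact: (svalP (rtl x)).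
    split => // i j; rewrite !mxE ord1; exact: (svalP (rtl (v 0 j))).
  exists (q, k) => // -[y w] [/= qy qw]; apply: rU.
  case: qxv => /= qx qv; split => /=.
    apply: (@le_ball _ _ _ (e k + e k)); first by rewrite [leRHS]splitr lerD// ltW.
    by apply: ball_triangle qy; exact: ball_sym.
  apply: (@le_ball _ _ _ (e k + e k)); first by rewrite [leRHS]splitr lerD// ltW.
  by apply: ball_triangle qw; exact: ball_sym.
rewrite bigcup_mkcond; apply: countable_bigcupT_measurable => // t.
case: ifPn => // _; apply: measurableX.
  exact: open_measurable (ball_open _ _).
exact: open_measurable_rV (ball_open _ _).
Qed.

Definition rV_cons n (p : R * 'rV[R]_n) : 'rV[R]_n.+1 := row_mx p.1%:M p.2.

Definition rV_uncons n (v : 'rV[R]_n.+1) : R * 'rV[R]_n :=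
  (v 0 0, \row_i v 0 (lift 0 i)).

Lemma rV_cons0 n (p : R * 'rV[R]_n) : rV_cons p 0 0 = p.1.
Proof. by rewrite !mxE; case: splitP => // j _; rewrite mxE !ord1 eqxx. Qed.

Lemma rV_consS n (p : R * 'rV[R]_n) i : rV_cons p 0 (lift 0 i) = p.2 0 i.
Proof.
rewrite !mxE; case: splitP => [[[]//]|k /= /eqP].
by rewrite !add1n eqSS => /eqP/val_inj ->.
Qed.

Lemma rV_consK n : cancel (@rV_cons n) (@rV_uncons n).
Proof.
move=> [a v]; rewrite /rV_uncons rV_cons0; congr pair.
by apply/rowP => i; rewrite mxE rV_consS.
Qed.

Lemma rV_unconsK n : cancel (@rV_uncons n) (@rV_cons n).
Proof.
move=> v; apply/rowP => i; have [j ->|->] := unliftP 0 i.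
  by rewrite rV_consS mxE.
by rewrite rV_cons0.
Qed.

Lemma rV_cons_continuous n : continuous (@rV_cons n).
Proof.
move=> p; apply/cvg_ballP => e e0.
exists (ball p.1 e, ball p.2 e); first by split; exact: nbhsx_ballx.
move=> q [/= q1 [_ q2]]; split => // i j; rewrite ord1.
have [k ->|->] := unliftP 0 j; last by rewrite !rV_cons0.
by rewrite !rV_consS.
Qed.

Lemma measurable_rV_cons n : measurable_fun setT (@rV_cons n).
Proof.
apply: (measurability (@open 'rV[R]_n.+1)) => // _ [U oU <-].
rewrite setTI; apply: open_measurable_prod_rV.
by move/continuousP: (@rV_cons_continuous n); exact.
Qed.

Lemma measurable_rV_uncons n : measurable_fun setT (@rV_uncons n).
Proof.
apply/measurable_fun_pairP; split.
  by apply: continuous_measurable_rV => v; exact: (@coord_continuous R 1 n.+1 0 0).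
apply: (measurability (@open 'rV[R]_n)) => // _ [U oU <-].
rewrite setTI; apply: open_measurable_rV.
suff : continuous (fun v : 'rV[R]_n.+1 => \row_i v 0 (lift 0 i) : 'rV[R]_n).
  by move/continuousP; exact.
move=> v A /= /nbhs_ballP[e /= e0 eA]; apply/nbhs_ballP; exists e => //= w.
by move=> [_ vw]; apply: eA; split => // i j; rewrite !mxE; exact: vw.
Qed.

Section step.
Context n (mu : {sigma_finite_measure set 'rV[R]_n -> \bar R}).

Definition leb_step : set 'rV[R]_n.+1 -> \bar R :=
  pushforward (@lebesgue_measure R \x mu)%E (@rV_cons n).

Let leb_step0 : leb_step set0 = 0%E.
Proof. by rewrite /leb_step /pushforward preimage_set0 measure0. Qed.

Let leb_step_ge0 A : (0 <= leb_step A)%E.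
Proof. by rewrite /leb_step /pushforward. Qed.

Let mcons A : measurable A -> measurable (@rV_cons n @^-1` A).
Proof. by move=> mA; rewrite -[X in measurable X]setTI; exact: measurable_rV_cons. Qed.

Let leb_step_sigma_additive : semi_sigma_additive leb_step.
Proof.
move=> F mF tF mUF; rewrite /leb_step /pushforward preimage_bigcup.
apply: measure_semi_sigma_additive => [k||].
- exact: mcons.
- apply/trivIsetP => /= i j _ _ ij; rewrite -preimage_setI.
  by move/trivIsetP : tF => /(_ _ _ _ _ ij) ->//; rewrite preimage_set0.
- by rewrite -preimage_bigcup; exact: mcons.
Qed.

HB.instance Definition _ := isMeasure.Build _ _ _ leb_step
  leb_step0 leb_step_ge0 leb_step_sigma_additive.

Let leb_step_sigma_finite : sigma_finite setT leb_step.
Proof.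
have /sigma_finiteP[F [FT ndF Foo]] := sigma_finiteT (@lebesgue_measure R).
have /sigma_finiteP[G [GT ndG Goo]] := sigma_finiteT mu.
exists (fun k => @rV_uncons n @^-1` (F k `*` G k)).
  apply/seteqP; split => // v _.
  have [i _ Fi] : (\bigcup_i F i) (rV_uncons v).1 by rewrite -FT.
  have [j _ Gj] : (\bigcup_i G i) (rV_uncons v).2 by rewrite -GT.
  exists (maxn i j) => //; split.
    by move: Fi; exact/subsetPset/ndF/leq_maxl.
  by move: Gj; exact/subsetPset/ndG/leq_maxr.
move=> k; have [mFk Fkoo] := Foo k; have [mGk Gkoo] := Goo k; split.
  rewrite -[X in measurable X]setTI; apply: measurable_rV_uncons => //.
  exact: measurableX.
rewrite /leb_step /pushforward -comp_preimage.
rewrite (_ : _ \o _ = id); last by apply/funext => p /=; rewrite rV_consK.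
by rewrite preimage_id product_measure1E// lte_mul_pinfty// ge0_fin_numE.
Qed.

HB.instance Definition _ := Measure_isSigmaFinite.Build _ _ _ leb_step
  leb_step_sigma_finite.

End step.

(* The (n.+1)-dimensional measure is the image of the product of the
   1-dimensional and the n-dimensional ones under (t, v) |-> (t, v_1, .., v_n). *)
Fixpoint lebesgue_rV (n : nat) : {sigma_finite_measure set 'rV[R]_n -> \bar R} :=
  match n with
  | 0 => \d_(0 : 'rV[R]_0)
  | n'.+1 => leb_step (lebesgue_rV n')
  end.

(* This determines [lebesgue_rV n] among the measures on the Borel sets. *)
Lemma lebesgue_rV_box n (a b : 'rV[R]_n) : (forall i, a 0 i <= b 0 i) ->
  lebesgue_rV n [set x : 'rV[R]_n | forall i, a 0 i < x 0 i <= b 0 i] =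
  (\prod_(i < n) (b 0 i - a 0 i))%:E.
Proof.
elim: n a b => [|n ih] a b ab.
  by rewrite big_ord0/= diracE mem_set// => -[].
pose a' := (rV_uncons a).2; pose b' := (rV_uncons b).2.
have mbox : measurable [set x : 'rV[R]_n | forall i, a' 0 i < x 0 i <= b' 0 i].
  rewrite (_ : mkset _ = \bigcap_(i in [set: 'I_n])
      ((fun x : 'rV[R]_n => x 0 i) @^-1` `]a' 0 i, b' 0 i]%classic)); last first.
    apply/seteqP; split => x /=.
      by move=> h i _ /=; rewrite in_itv/=.
    by move=> h i; have := h i I; rewrite /= in_itv.
  apply: fin_bigcap_measurable => // i _; rewrite -[X in measurable X]setTI.
  by apply: continuous_measurable_rV => //; exact: coord_continuous.
have consE : @rV_cons n @^-1` [set x | forall i, a 0 i < x 0 i <= b 0 i] =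
    `]a 0 0, b 0 0]%classic `*`
    [set x : 'rV[R]_n | forall i, a' 0 i < x 0 i <= b' 0 i].
  apply/seteqP; split => [p h|p [/= p1 p2] i].
    split => /=; first by have := h 0; rewrite rV_cons0 in_itv.
    by move=> i; have := h (lift 0 i); rewrite rV_consS !mxE.
  have [j ->|->] := unliftP 0 i.
    by rewrite rV_consS; have := p2 j; rewrite !mxE.
  by rewrite rV_cons0; rewrite in_itv in p1.
transitivity ((@lebesgue_measure R \x lebesgue_rV n)%E
    (@rV_cons n @^-1` [set x | forall i, a 0 i < x 0 i <= b 0 i])) => //.
rewrite consE product_measure1E //=.
rewrite [X in (_ * X)%E]ih; last by move=> i; rewrite !mxE.
rewrite lebesgue_measure_itv/= lte_fin big_ord_recl EFinM; congr (_ * _)%E.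
  case: ltP => // ba; have -> : b 0 0 = a 0 0 by apply/le_anti; rewrite ba ab.
  by rewrite subrr.
by congr EFin; apply: eq_bigr => i _; rewrite !mxE.
Qed.

End rV_lebesgue.

Section analysis_rV.
Context (R : realType) (d : nat).
Implicit Types (f u phi : 'rV[R]_d -> R) (G : 'rV[R]_d -> 'rV[R]_d).

Local Notation mu := (lebesgue_rV R d).

Definition partial_derive (i : 'I_d) phi : 'rV[R]_d -> R :=
  fun x => 'D_(delta_mx 0 i) phi x.

(* The gradient of [phi] at [x] when [phi] is differentiable there. *)
Definition grad phi (x : 'rV[R]_d) : 'rV[R]_d :=
  \row_i partial_derive i phi x.

Fixpoint class_C (k : nat) phi : Prop :=
  continuous phi /\
  if k is k'.+1 then
    forall i, (forall x, derivable phi x (delta_mx 0 i)) /\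
              class_C k' (partial_derive i phi)
  else True.

Definition test_function phi : Prop :=
  (forall k, class_C k phi) /\ compact (closure [set x | phi x != 0]).

Definition L1_loc u : Prop :=
  measurable_fun [set: 'rV[R]_d] u /\
  forall K, compact K -> (\int[mu]_(y in K) `|u y|%:E < +oo)%E.

Definition is_weak_gradient u G : Prop :=
  forall i : 'I_d,
    L1_loc (fun y => G y 0 i) /\
    forall phi, test_function phi ->
      (\int[mu]_y (u y * partial_derive i phi y) =
       - \int[mu]_y (G y 0 i * phi y))%R.

Definition W11_loc u : Prop := L1_loc u /\ exists G, is_weak_gradient u G.

(* Almost everywhere, as elements of L^1_loc are classes of functions. *)
Definition radial u : Prop :=
  exists g : R -> R, {ae mu, forall y, u y = g (enorm y)}.

Definition volume (A : set 'rV[R]_d) : R := fine (mu A).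

(* For r = 0 and beta > 0 this is 0, because 0 `^ beta = 0. *)
Definition frac_avg (beta : R) f (z : 'rV[R]_d) (r : R) : \bar R :=
  ((r `^ beta / volume (eball z r))%:E *
   \int[mu]_(y in eball z r) `|f y|%:E)%E.

Definition frac_max (beta : R) f (x : 'rV[R]_d) : \bar R :=
  ereal_sup [set frac_avg beta f x r | r in [set r | 0 <= r]].

Definition frac_max_nc (beta : R) f (x : 'rV[R]_d) : \bar R :=
  ereal_sup [set frac_avg beta f b.1 b.2 | b in
    [set b : 'rV[R]_d * R | eball b.1 b.2 x]].

(* Good balls are represented by their radius, resp. centre and radius. *)
Definition good_balls (beta : R) f (x : 'rV[R]_d) : set R :=
  [set r | 0 < r /\ frac_max beta f x = frac_avg beta f x r].

Definition good_balls_nc (beta : R) f (x : 'rV[R]_d) : set ('rV[R]_d * R) :=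
  [set b | [/\ 0 < b.2, closed_eball b.1 b.2 x &
               frac_max_nc beta f x = frac_avg beta f b.1 b.2]].

(* [fine] sends +oo to 0, so finiteness near [x] has to be required. *)
Definition ediff_at (h : 'rV[R]_d -> \bar R) (x : 'rV[R]_d) : Prop :=
  (\forall y \near x, h y \is a fin_num) /\ differentiable (fine \o h) x.

Definition egrad (h : 'rV[R]_d -> \bar R) (x : 'rV[R]_d) : 'rV[R]_d :=
  grad (fine \o h) x.

Definition mean (A : set 'rV[R]_d) u : R :=
  (volume A)^-1 * (\int[mu]_(y in A) u y)%R.

Definition mean_vec (A : set 'rV[R]_d) G : 'rV[R]_d :=
  \row_i mean A (fun y => G y 0 i).

End analysis_rV.

(* Main.v *)
(* M f dominates the average over any ball centred at the point, with equality
   at a good ball. Hence along a curve through x their difference has a minimum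
   at x, and the derivatives of M f and of the average agree. Translating the
   good ball gives grad M f (x) = r^beta mean_B (grad |f|). Dilating it about the
   origin gives grad M f (x) . x = beta M f (x) + r^beta mean_B (grad |f| . y),
   and likewise for the non-centred function. Since M f is radial, grad M f (x)
   is parallel to x. The first inequality is then Cauchy-Schwarz, and the second
   one is M f <= M~ f.

   The motions of a ball are those of S_t w = w + t (c w + v), with c = 0 for
   translations and c = 1, v = 0 for dilations. The integral of |f| over
   S_t^-1 B is differentiated by approximating the indicator of B by the test
   functions exp (- 1 / (n (r^2 - |y - z|^2))), n -> oo. That M f is radial uses
   the invariance of Lebesgue measure under reflections, which follows from the
   uniqueness of Haar measure. *)
Require Import Defs.
From mathcomp Require Import all_boot all_order all_algebra.
From mathcomp Require Import all_classical all_reals all_analysis.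
From mathcomp Require Import measurable_realfun ring lra.

Set Implicit Arguments.
Unset Strict Implicit.
Unset Printing Implicit Defensive.

Import Order.TTheory GRing.Theory Num.Theory.
Import numFieldNormedType.Exports.

Local Open Scope classical_set_scope.
Local Open Scope ring_scope.

(** * Lebesgue measure on row vectors *)

(** The obstacle is that |f| has only a weak gradient, so its integral over a moving ball cannot be
    differentiated through a boundary integral. Since [flow t] has spatial derivative (1 + c t) Id
    and time derivative [field], the cutoffs satisfy (1 + c t) d/dt cutoff = grad cutoff . field.
    Testing the weak gradient against cutoff * field thus replaces the time derivative by integrals
    that contain the cutoff itself, and these have limits. The exchange of n -> oo and t -> 0
    remains: the available bound on d/dt cutoff grows with n, so n is chosen along a diagonal, and
    the cutoff limits let index and time vary together. For dilations the volume in the average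
    contributes d and the divergence of the field contributes -d. They cancel, only the exponent
    beta survives, and this produces the term beta M f(x). Balls are moved by the inverse flow,
    which accounts for the minus signs until the formulas for the gradient are reached. Translations
    and dilations of the measure can be checked on boxes. A general reflection does not map boxes to
    boxes, hence the detour through Haar uniqueness. *)

Definition rV_box (R : realType) n (a b : 'rV[R]_n) : set 'rV[R]_n :=
  [set x | forall i, a 0 i < x 0 i <= b 0 i].

(** Half-open boxes are stable under intersection and generate the Borel sets, so a measure that is
    finite on them is determined by its values there. *)
Definition rV_boxes (R : realType) n : set_system 'rV[R]_n :=
  [set A | exists a b, A = rV_box a b].

Section boxes.
Context (R : realType) (n : nat).
Implicit Types a b : 'rV[R]_n.

Lemma rV_boxE a b : rV_box a b =
  \bigcap_(i in [set: 'I_n]) ((fun x : 'rV[R]_n =>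
      x 0 i) @^-1` `]a 0 i, b 0 i]%classic).
Proof.
apply/seteqP; split => x /=; first by move=> h i _ /=; rewrite in_itv/=.
by move=> h i; have := h i I; rewrite /= in_itv.
Qed.

Lemma measurable_coord d (T : measurableType d) (f : T -> 'rV[R]_n) i :
  measurable_fun setT f -> measurable_fun setT (fun x => f x 0 i).
Proof.
move=> mf; apply: (measurableT_comp (f := fun v : 'rV[R]_n => v 0 i)) => //.
by apply: continuous_measurable_rV; exact: coord_continuous.
Qed.

Lemma measurable_rV_box a b : measurable (rV_box a b).
Proof.
rewrite rV_boxE; apply: fin_bigcap_measurable => // i _.
rewrite -[X in measurable X]setTI.
by apply: (measurable_coord (f := id)).
Qed.

Lemma rV_boxI a1 b1 a2 b2 : rV_box a1 b1 `&` rV_box a2 b2 =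
  rV_box (\row_i Num.max (a1 0 i) (a2 0 i)) (\row_i Num.min (b1 0 i) (b2 0 i)).
Proof.
apply/seteqP; split => x /=.
  move=> [h1 h2] i; rewrite !mxE gt_max le_min.
  by have /andP[? ?] := h1 i; have /andP[? ?] := h2 i; apply/andP; split; apply/andP.
by move=> h; split=> i; have := h i; rewrite !mxE gt_max le_min =>
  /andP[/andP[? ?] /andP[? ?]]; apply/andP.
Qed.

(** The boxes with rational centre and half side 1/(k+1) that lie inside [U] are countably many and
    cover it. *)
Lemma open_bigcup_rV_box (U : set 'rV[R]_n) : open U ->
  <<s @rV_boxes R n >> U.
Proof.
move=> oU.
pose e (k : nat) : R := k.+1%:R^-1.
pose bx (t : 'rV[rat]_n * nat) : set 'rV[R]_n :=
  rV_box (\row_i (ratr (t.1 0 i) - e t.2)) (\row_i (ratr (t.1 0 i) + e t.2)).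
pose I : set ('rV[rat]_n * nat) := [set t | bx t `<=` U].
have -> : U = \bigcup_(t in I) bx t.
  apply/seteqP; split => [v Uv|p [t It /It//]].
  have /nbhs_ballP[r /= r0 rU] : nbhs v U by exact: open_nbhs_nbhs.
  have [k ek] : exists k, e k < r / 2.
    by have [k _ /(_ k (leqnn k))/=] := near_infty_natSinv_lt
      (PosNum (divr_gt0 r0 (ltr0n R 2))); exists k.
  have e0 : 0 < e k by rewrite invr_gt0 ltr0n.
  have rtl (a : R) : {q : rat | a - e k < ratr q < a + e k}.
    apply: cid; have [|q] := @rat_in_itvoo R (a - e k) (a + e k).
      by rewrite ltrBlDr -addrA ltrDl addr_gt0.
    by rewrite in_itv/= => qa; exists q.
  pose q : 'rV[rat]_n := \row_i sval (rtl (v 0 i)).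
  exists (q, k) => /=.
    move=> w /= qw; apply: rU; split => // i j; rewrite ord1.
    have := qw j; rewrite !mxE; case: (rtl _) => /= p.
    rewrite /ball/= ltr_norml; lra.
  by move=> i; rewrite !mxE; case: (rtl _) => /= p; lra.
rewrite bigcup_mkcond.
pose BT := g_sigma_algebraType (@rV_boxes R n).
apply: (@countable_bigcupT_measurable _ BT) => // t.
case: ifPn => // _; apply: sub_sigma_algebra.
by do 2 eexists.
Qed.

Lemma measurable_rV_boxesE :
  @measurable _ 'rV[R]_n = <<s @rV_boxes R n >>.
Proof.
apply/seteqP; split => A.
  apply: smallest_sub; first exact: smallest_sigma_algebra.
  exact: open_bigcup_rV_box.
apply: smallest_sub; first exact: sigma_algebra_measurable.
by move=> _ [a [b ->]]; exact: measurable_rV_box.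
Qed.

Lemma measurable_fun_rV d (T : measurableType d) (f : T -> 'rV[R]_n) :
  (forall i, measurable_fun setT (fun x => f x 0 i)) -> measurable_fun setT f.
Proof.
move=> mf; apply: (measurability (@rV_boxes R n)).
  exact: measurable_rV_boxesE.
move=> _ [_ [a [b ->]] <-]; rewrite setTI rV_boxE preimage_bigcap.
apply: fin_bigcap_measurable => // i _; rewrite -comp_preimage.
by rewrite -[X in measurable X]setTI; exact: mf.
Qed.

Lemma bigcup_rV_box :
  \bigcup_k rV_box (const_mx (- k%:R)) (const_mx k%:R) = [set: 'rV[R]_n].
Proof.
apply/seteqP; split => // x _; exists (Num.bound `|x|) => // i; rewrite !mxE.
have xi : `|x 0 i| <= `|x| by rewrite /Num.norm/= mx_normrE;
  exact: (le_bigmax_cond _ (fun ij : 'I_1 * 'I_n => `|x ij.1 ij.2|) (erefl :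
      xpredT (0, i))).
have := archi_boundP (normr_ge0 x); move: xi; rewrite ler_norml; lra.
Qed.

Lemma rV_boxes_measure_unique
    (m1 : {sigma_finite_measure set 'rV[R]_n -> \bar R})
    (m2 : {measure set 'rV[R]_n -> \bar R}) :
  (forall a b, (forall i, a 0 i <= b 0 i) -> m1 (rV_box a b) = m2 (rV_box a b)) ->
  (forall a b, (forall i, a 0 i <= b 0 i) -> (m1 (rV_box a b) < +oo)%E) ->
  forall A, measurable A -> m1 A = m2 A.
Proof.
move=> m12 m1oo; apply: (measure_unique (@rV_boxes R n)
  (fun k => rV_box (const_mx (- k%:R)) (const_mx k%:R))).
- exact: measurable_rV_boxesE.
- by move=> _ _ [a1 [b1 ->]] [a2 [b2 ->]]; rewrite rV_boxI; do 2 eexists.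
- by move=> k; do 2 eexists.
- exact: bigcup_rV_box.
- move=> _ [a [b ->]].
  have [->|/set0P[x xab]] := eqVneq (rV_box a b) set0; first by rewrite !measure0.
  by apply: m12 => i; move: (xab i) => /andP[]; lra.
- by move=> k; apply: m1oo => i; rewrite !mxE; have := ler0n R k; lra.
Qed.

End boxes.

Section affine.
Context (R : realType) (n : nat).
Local Notation mu := (lebesgue_rV R n).

Lemma measure_rV_box (a b : 'rV[R]_n) : (forall i, a 0 i <= b 0 i) ->
  mu (rV_box a b) = (\prod_(i < n) (b 0 i - a 0 i))%:E.
Proof. exact: lebesgue_rV_box. Qed.

Lemma measurable_affine (s : R) (a : 'rV[R]_n) :
  measurable_fun setT (fun x : 'rV[R]_n => s *: x + a).
Proof.
apply: measurable_fun_rV => i; under eq_fun do rewrite !mxE.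
apply: measurable_funD => //; apply: measurable_funM => //.
exact: (measurable_coord (f := id)).
Qed.

(** For s > 0 the preimage of a half-open box is again a half-open box, with each side divided by s;
    uniqueness on boxes does the rest. *)
Lemma lebesgue_rV_affine (s : R) (a : 'rV[R]_n) A : 0 < s -> measurable A ->
  mu A = ((s ^+ n)%:E * mu ((fun x : 'rV[R]_n => (s *: x + a)%R) @^-1` A))%E.
Proof.
move=> s0.
pose T (x : 'rV[R]_n) := s *: x + a.
pose m2 : {measure set 'rV[R]_n -> \bar R} :=
  mscale (NngNum (exprn_ge0 n (ltW s0))) (pushforward mu T).
have sn0 : s != 0 by rewrite gt_eqF.
suff : forall B, measurable B -> mu B = m2 (measurable_affine s a) B by move=> /[apply].
apply: rV_boxes_measure_unique => c b cb; last first.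
  by rewrite measure_rV_box// ltry.
rewrite measure_rV_box//; transitivity ((s ^+ n)%:E * mu (T @^-1` rV_box c b))%E => //.
pose f (c : 'rV[R]_n) := s^-1 *: (c - a).
rewrite (_ : T @^-1` _ = rV_box (f c) (f b)); last first.
  apply/seteqP; split => x /= h i; have := h i; rewrite /f /T !mxE.
    by rewrite ler_pdivlMl// ltr_pdivrMl// lerBrDr ltrBlDr.
  by rewrite ler_pdivlMl// ltr_pdivrMl// lerBrDr ltrBlDr.
rewrite measure_rV_box; last first.
  by move=> i; rewrite /f !mxE ler_pM2l ?invr_gt0// lerB.
rewrite -EFinM; congr EFin.
rewrite -[in s ^+ n](card_ord n) -prodr_const -big_split/=.
by apply: eq_bigr => i _; rewrite !mxE; field.
Qed.

Lemma lebesgue_rV_translation (a : 'rV[R]_n) A : measurable A ->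
  mu ((fun x : 'rV[R]_n => x + a) @^-1` A) = mu A.
Proof.
move=> mA; rewrite [RHS](lebesgue_rV_affine a ltr01 mA) expr1n mul1e.
have -> // : (fun x : 'rV[R]_n => x + a) = (fun x => 1 *: x + a).
by apply/funext => x; rewrite scale1r.
Qed.

Lemma measurable_rVD d (T : measurableType d) (f g : T -> 'rV[R]_n) :
  measurable_fun setT f -> measurable_fun setT g ->
  measurable_fun setT (fun x => f x + g x).
Proof.
move=> mf mg; apply: measurable_fun_rV => i; under eq_fun do rewrite !mxE.
by apply: measurable_funD => //; exact: measurable_coord.
Qed.

Lemma measurable_rVN d (T : measurableType d) (f : T -> 'rV[R]_n) :
  measurable_fun setT f -> measurable_fun setT (fun x => - f x).
Proof.
move=> mf; apply: measurable_fun_rV => i; under eq_fun do rewrite !mxE.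
by apply: measurableT_comp => //; exact: measurable_coord.
Qed.

(* Uniqueness of Haar measure: slicing {(x, y) | x \in A, T y - x \in B} along
   both axes gives mu A * mu B = mu B * mu (T^-1 A). *)
Lemma lebesgue_rV_involution (T : 'rV[R]_n -> 'rV[R]_n) (B A : set 'rV[R]_n) :
  measurable_fun setT T -> {morph T : x y / x + y} -> involutive T ->
  measurable B -> (forall x, B (T x) <-> B x) -> (forall x, B (- x) <-> B x) ->
  (0 < mu B < +oo)%E ->
  measurable A -> mu (T @^-1` A) = mu A.
Proof.
move=> mT TD TT mB TB NB /andP[muB0 muBoo] mA.
have TN x : T (- x) = - T x.
  have T0 : T 0 = 0 by apply: (addrI (T 0)); rewrite -TD !addr0.
  by apply: (addrI (T x)); rewrite -TD !subrr T0.
pose E := [set p : 'rV[R]_n * 'rV[R]_n | A p.1 /\ B (T p.2 - p.1)].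
pose E' := [set p : 'rV[R]_n * 'rV[R]_n | A (p.1 + T p.2) /\ B (- p.1)].
have mTsnd : measurable_fun setT (fun p : 'rV[R]_n * 'rV[R]_n => T p.2).
  exact: measurableT_comp.
have mE : measurable E.
  rewrite (_ : E = (fst @^-1` A) `&` ((fun p => T p.2 - p.1) @^-1` B))//.
  apply: measurableI; rewrite -[X in measurable X]setTI; first exact: measurable_fst.
  by apply: measurable_rVD => //; exact: measurable_rVN.
have mE' : measurable E'.
  rewrite (_ : E' = ((fun p => p.1 + T p.2) @^-1` A) `&` ((fun p => - p.1) @^-1` B))//.
  apply: measurableI; rewrite -[X in measurable X]setTI; first exact: measurable_rVD.
  exact: measurable_rVN.
have swap X : measurable X -> (mu \x mu)%E X = (mu \x^ mu)%E X.
  apply: product_measure_unique => C D mC mD; exact: product_measure2E.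
have mTA : measurable (T @^-1` A) by rewrite -[X in measurable X]setTI; exact: mT.
(* For fixed y the translation by [T y] matches the sections of [E] and [E']. Sections at fixed y
   require the product measure in its swapped form. *)
have EE' : (mu \x mu)%E E = (mu \x mu)%E E'.
  rewrite !swap//; apply: eq_integral => y _ /=.
  rewrite -(lebesgue_rV_translation (T y) (measurable_ysection y mE)).
  congr (mu _); apply/seteqP; split => x; rewrite /ysection/= !inE /E /E'/=.
    by rewrite opprD addrCA subrr addr0.
  by rewrite opprD addrCA subrr addr0.
have slice X C k : measurable X -> measurable C ->
    (forall x, C x -> mu (xsection X x) = k) ->
    (forall x, ~ C x -> xsection X x = set0) -> (mu \x mu)%E X = (k * mu C)%E.
  move=> mX mC XC XnC; rewrite -integral_cst// integral_mkcond.
  apply: eq_integral => x _; rewrite patchE /=; case: ifPn; rewrite ?inE ?notin_setE.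
    exact: XC.
  by move=> /XnC ->; rewrite measure0.
have E1 : (mu \x mu)%E E = (mu B * mu A)%E.
  apply: slice => // x Ax; last first.
    by apply/seteqP; split => y; rewrite /xsection/= !inE /E/=; [case|].
  rewrite -(lebesgue_rV_translation (- T x) mB); congr (mu _).
  apply/seteqP; split => y; rewrite /xsection/= !inE /E/=.
    by move=> [_ /TB]; rewrite TD TT TN.
  by move=> h; split => //; apply/TB; rewrite TD TT TN.
have E'1 : (mu \x mu)%E E' = (mu (T @^-1` A) * mu B)%E.
  apply: slice => // x Bx; last first.
    apply/seteqP; split => y; rewrite /xsection/= !inE /E'/=; [|by []].
    by case=> _ /NB.
  rewrite -(lebesgue_rV_translation (T x) mTA); congr (mu _).
  apply/seteqP; split => y; rewrite /xsection/= !inE /E'/=.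
    by move=> [h _]; rewrite TD TT addrC.
  by rewrite TD TT addrC => h; split => //; exact/NB.
have : (mu B * mu A = mu B * mu (T @^-1` A))%E by rewrite -E1 EE' E'1 muleC.
have mufin : mu B \is a fin_num by rewrite ge0_fin_numE.
have -> : mu B = (fine (mu B))%:E by rewrite fineK.
move=> /(congr1 (fun z => ((fine (mu B))^-1)%:E * z)%E).
have h : fine (mu B) != 0 by rewrite fine_eq0// gt_eqF.
by rewrite !muleA -!EFinM mulVf// !mul1e.
Qed.

End affine.

(** * Euclidean balls *)

Section dotp.
Context (R : realType) (n : nat).
Implicit Types (u v w : 'rV[R]_n) (a : R).

Lemma dotpC u v : dotp u v = dotp v u.
Proof. by apply: eq_bigr => i _; rewrite mulrC. Qed.

Lemma dotpDl u v w : dotp (u + v) w = dotp u w + dotp v w.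
Proof. by rewrite -big_split; apply: eq_bigr => i _; rewrite mxE mulrDl. Qed.

Lemma dotpZl a u w : dotp (a *: u) w = a * dotp u w.
Proof. by rewrite mulr_sumr; apply: eq_bigr => i _; rewrite mxE mulrA. Qed.

Lemma dotp0l u : dotp 0 u = 0.
Proof. by rewrite /dotp big1// => i _; rewrite mxE mul0r. Qed.

Lemma dotpNl u w : dotp (- u) w = - dotp u w.
Proof. by rewrite -scaleN1r dotpZl mulN1r. Qed.

Lemma dotpBl u v w : dotp (u - v) w = dotp u w - dotp v w.
Proof. by rewrite dotpDl dotpNl. Qed.

Lemma dotpDr u v w : dotp w (u + v) = dotp w u + dotp w v.
Proof. by rewrite dotpC dotpDl !(dotpC w). Qed.

Lemma dotpZr a u w : dotp w (a *: u) = a * dotp w u.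
Proof. by rewrite dotpC dotpZl dotpC. Qed.

Lemma dotpNr u w : dotp w (- u) = - dotp w u.
Proof. by rewrite dotpC dotpNl dotpC. Qed.

Lemma dotpBr u v w : dotp w (u - v) = dotp w u - dotp w v.
Proof. by rewrite dotpDr dotpNr. Qed.

Lemma dotp_ge0 u : 0 <= dotp u u.
Proof. by apply: sumr_ge0 => i _; rewrite -expr2 sqr_ge0. Qed.

Lemma dotp_eq0 u : (dotp u u == 0) = (u == 0).
Proof.
apply/idP/eqP => [|->]; last by rewrite dotp0l.
rewrite /dotp psumr_eq0 => [/allP h|i _]; last by rewrite -expr2 sqr_ge0.
apply/rowP => i; have := h i; rewrite mem_index_enum mxE => /(_ erefl) /=.
by rewrite mulf_eq0 orbb => /eqP.
Qed.

Lemma dotp_delta u i : dotp u (delta_mx 0 i) = u 0 i.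
Proof.
rewrite /dotp (bigD1 i)//= mxE !eqxx mulr1 big1 ?addr0// => j ji.
by rewrite mxE (negbTE ji) andbF mulr0.
Qed.

Lemma enorm_ge0 u : 0 <= enorm u.
Proof. exact: sqrtr_ge0. Qed.

Lemma sqr_enorm u : enorm u ^+ 2 = dotp u u.
Proof. by rewrite sqr_sqrtr// dotp_ge0. Qed.

Lemma enormZ a u : enorm (a *: u) = `|a| * enorm u.
Proof.
by rewrite /enorm dotpZl dotpZr mulrA -expr2 sqrtrM ?sqr_ge0// sqrtr_sqr.
Qed.

Lemma enormN u : enorm (- u) = enorm u.
Proof. by rewrite -scaleN1r enormZ normrN1 mul1r. Qed.

Lemma enorm_gt0 u : (0 < enorm u) = (u != 0).
Proof. by rewrite sqrtr_gt0 lt_neqAle dotp_ge0 andbT eq_sym dotp_eq0. Qed.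

Lemma enorm_lt u a : 0 < a -> (enorm u < a) = (dotp u u < a ^+ 2).
Proof.
by move=> a0; rewrite -sqr_enorm ltr_pXn2r// nnegrE ?enorm_ge0// ltW.
Qed.

Lemma enorm_le u a : 0 <= a -> (enorm u <= a) = (dotp u u <= a ^+ 2).
Proof. by move=> a0; rewrite -sqr_enorm ler_pXn2r// nnegrE ?enorm_ge0. Qed.

(** Cauchy-Schwarz, read off from the squared norm of [dotp v v *: u - dotp u v *: v]. *)
Lemma ler_dotp u v : dotp u v <= enorm u * enorm v.
Proof.
have [->|v0] := eqVneq v 0.
  by rewrite dotpC dotp0l mulr_ge0 ?enorm_ge0.
have [h|h] := ltP (dotp u v) 0.
  by rewrite (le_trans (ltW h))// mulr_ge0 ?enorm_ge0.
have := dotp_ge0 (dotp v v *: u - dotp u v *: v).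
rewrite dotpBl !dotpBr !(dotpZl, dotpZr) (dotpC v u) => hh.
have vv : 0 < dotp v v by rewrite lt_neqAle dotp_ge0 andbT eq_sym dotp_eq0.
rewrite -ler_sqr ?nnegrE ?mulr_ge0 ?enorm_ge0// exprMn !sqr_enorm.
rewrite -(ler_pM2l vv); nra.
Qed.

Lemma coord_le_enorm u i : `|u 0 i| <= enorm u.
Proof.
rewrite -(@ger0_norm _ (enorm u)) ?enorm_ge0// -ler_sqr ?nnegrE// !real_normK
    ?num_real//.
rewrite sqr_enorm /dotp (bigD1 i)//= -expr2 lerDl sumr_ge0// => j _.
by rewrite -expr2 sqr_ge0.
Qed.

Lemma enorm_le_sum u : enorm u <= \sum_(i < n) `|u 0 i|.
Proof.
rewrite enorm_le ?sumr_ge0// expr2 mulr_suml; apply: ler_sum => i _.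
rewrite -expr2 -[u 0 i ^+ 2]real_normK ?num_real// expr2 ler_wpM2l//.
by rewrite (bigD1 i)//= lerDl sumr_ge0.
Qed.

Lemma continuous_rV (T : topologicalType) (f : T -> 'rV[R]_n) :
  (forall i, continuous (fun x => f x 0 i)) -> continuous f.
Proof.
move=> fc x; apply/cvg_ballP => e e0.
have : \forall y \near x, forall i, ball (f x 0 i) e (f y 0 i).
  by apply: filter_forall => i; have /cvg_ballP := fc i x; apply.
by apply: filterS => y h; split => // i j; rewrite ord1.
Qed.

Lemma dotp_continuous (T : topologicalType) (f g : T -> 'rV[R]_n) :
  continuous f -> continuous g -> continuous (fun x => dotp (f x) (g x)).
Proof.
move=> cf cg x; apply: cvg_big => [|i _]; first exact: add_continuous.
apply: cvgM.
  by apply: (@continuous_comp _ _ _ f (fun v : 'rV[R]_n => v 0 i)); [exact: cf|exact: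
      coord_continuous].
by apply: (@continuous_comp _ _ _ g (fun v : 'rV[R]_n => v 0 i)); [exact: cg|exact:
    coord_continuous].
Qed.

Lemma enorm_continuous (T : topologicalType) (f : T -> 'rV[R]_n) :
  continuous f -> continuous (fun x => enorm (f x)).
Proof.
move=> cf x; apply: (@continuous_comp _ _ _ (fun x => dotp (f x) (f x)) Num.sqrt).
  exact: dotp_continuous.
exact: sqrt_continuous.
Qed.

End dotp.

Section balls.
Context (R : realType) (n : nat).
Local Notation mu := (lebesgue_rV R n).
Implicit Types (z : 'rV[R]_n) (r : R).

Lemma measurable_enorm_subr z : measurable_fun setT (fun y : 'rV[R]_n => enorm (y - z)).
Proof.
apply: continuous_measurable_rV; apply: enorm_continuous => y.
by apply: (@continuousB _ 'rV[R]_n _ id (cst z)); [exact: cvg_id|exact: cst_continuous].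
Qed.

Lemma measurable_eball z r : measurable (eball z r).
Proof.
rewrite (_ : eball z r = (fun y : 'rV[R]_n => enorm (y - z)) @^-1` `]-oo, r[%classic).
  by rewrite -[X in measurable X]setTI; exact: measurable_enorm_subr.
by apply/seteqP; split => y /=; rewrite in_itv.
Qed.

Lemma measurable_esphere z r : measurable [set y : 'rV[R]_n | enorm (y - z) = r].
Proof.
rewrite (_ : mkset _ = (fun y : 'rV[R]_n => enorm (y - z)) @^-1` [set r])//.
by rewrite -[X in measurable X]setTI; exact: measurable_enorm_subr.
Qed.

Lemma mu_eball z r : 0 < r -> mu (eball z r) = ((r ^+ n)%:E * mu (eball 0 1))%E.
Proof.
move=> r0; rewrite (lebesgue_rV_affine z r0 (measurable_eball _ _)).
congr (_ * _)%E; congr (_ _); apply/seteqP; split => y;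
    rewrite /eball/= addrK subr0 enormZ gtr0_norm// => h.
  by rewrite -(ltr_pM2l r0) mulr1.
by rewrite -[ltRHS]mulr1 ltr_pM2l.
Qed.

Lemma mu_eball1 : (0 < mu (eball 0 1) < +oo)%E.
Proof.
apply/andP; split.
  (* A point of the cube of half side 1/(n+1) has squared norm at most n/(n+1)^2, which is below 1
     even for n = 0. *)
  pose e : R := n.+1%:R^-1.
  have e0 : 0 < e by rewrite invr_gt0.
  have : (mu (rV_box (const_mx (- e)%R) (const_mx e)) <= mu (eball 0 1))%E.
    apply: le_measure; rewrite ?inE; [exact: measurable_rV_box|exact:
        measurable_eball|].
    move=> y ye; rewrite /eball/= subr0 enorm_lt// expr1n.
    have : dotp y y <= \sum_(i < n) e ^+ 2.
      apply: ler_sum => i _; have := ye i; rewrite !mxE -expr2 => /andP[h1 h2].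
      rewrite !expr2; nra.
    move=> /le_lt_trans; apply; rewrite sumr_const card_ord -mulr_natl expr2.
    have h1 : n.+1%:R * e = 1 by rewrite mulfV// pnatr_eq0.
    have h2 : e <= 1 by rewrite invf_le1 ?ler1n// ltr0n.
    by move: h1; rewrite mulrSr => h1; nra.
  apply: lt_le_trans; rewrite measure_rV_box; last first.
    by move=> i; rewrite !mxE; lra.
  rewrite lte_fin; apply: prodr_gt0 => i _; rewrite !mxE; lra.
apply: (@le_lt_trans _ _ (mu (rV_box (const_mx (- 2 : R)%R) (const_mx (2 : R)%R)))).
  apply: le_measure; rewrite ?inE; [exact: measurable_eball|exact: measurable_rV_box|].
  move=> y; rewrite /eball/= subr0 => y1 i; rewrite !mxE.
  have := le_lt_trans (coord_le_enorm y i) y1; rewrite ltr_norml; lra.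
by rewrite measure_rV_box ?ltry// => i; rewrite !mxE; lra.
Qed.

Lemma volume_eball z r : 0 < r -> volume (eball z r) = r ^+ n * volume (eball (0 :
    'rV[R]_n) 1).
Proof.
move=> r0; rewrite /volume mu_eball// fineM//.
by have /andP[h1 h2] := mu_eball1; rewrite ge0_fin_numE.
Qed.

Lemma volume_eball1_gt0 : 0 < volume (eball (0 : 'rV[R]_n) 1).
Proof. by rewrite fine_gt0// mu_eball1. Qed.

Lemma mu_eballE z r : 0 < r ->
  mu (eball z r) = (r ^+ n * volume (eball (0 : 'rV[R]_n) 1))%:E.
Proof.
move=> r0; rewrite mu_eball// EFinM fineK//.
by have /andP[h1 h2] := mu_eball1; rewrite ge0_fin_numE.
Qed.

(** The sphere lies in the shell between radii r and s r for every s > 1, and the volume of the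
    shell tends to 0 as s -> 1. *)
Lemma mu_esphere z r : 0 < r -> mu [set y : 'rV[R]_n | enorm (y - z) = r] = 0%E.
Proof.
move=> r0; set S := mkset _; pose V := volume (eball (0 : 'rV[R]_n) 1).
have h (s : R) : 1 < s -> (mu S <= (((s * r) ^+ n - r ^+ n) * V)%:E)%E.
  move=> s1; have s0 : 0 < s by rewrite (lt_trans _ s1).
  have rsr : r < s * r by rewrite -[ltLHS]mul1r ltr_pM2r.
  have : (mu S + mu (eball z r) <= mu (eball z (s * r)))%E.
    rewrite -measureU//; [|exact: measurable_esphere|exact: measurable_eball|].
      apply: le_measure; rewrite ?inE.
      - by apply: measurableU; [exact: measurable_esphere|exact: measurable_eball].
      - exact: measurable_eball.
      - by move=> y [yS|/lt_trans]; [rewrite /eball/= yS|apply].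
    by apply/seteqP; split => y //= [yS]; rewrite /eball/= yS ltxx.
  by rewrite !mu_eballE ?mulr_gt0// mulrBl EFinB leeBrDr.
have Sfin : mu S \is a fin_num.
  by rewrite ge0_fin_numE// (le_lt_trans (h 2 _))// ?ltry// ltr1n.
apply/eqP; rewrite eq_le measure_ge0 andbT -(fineK Sfin) lee_fin.
pose s k : R := 1 + k.+1%:R^-1.
have s1 : s @ \oo --> (1 : R).
  rewrite -[X in _ --> X]addr0; apply: cvgD; first exact: cvg_cst.
  exact: cvg_harmonic.
have : (fun k => ((s k * r) ^+ n - r ^+ n) * V) @ \oo --> ((1 * r) ^+ n - r ^+ n) * V.
  apply: cvgM; last exact: cvg_cst.
  apply: cvgB; last exact: cvg_cst.
  apply: (@cvg_comp _ _ _ (fun k => s k * r) (fun x : R => x ^+ n) _ (nbhs (1 * r))).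
    by apply: cvgM => //; exact: cvg_cst.
  exact: exprn_continuous.
rewrite mul1r subrr mul0r => /(ler_cvg_to (cvg_cst (fine (mu S)))); apply.
apply: nearW => k; rewrite -lee_fin fineK//; apply: h.
by rewrite ltrDl invr_gt0.
Qed.

End balls.

(** * Smooth cutoffs *)

Section bexp.
Context {R : realType}.
Implicit Types (x : R) (j m : nat).

(* The span of this family is closed under differentiation, so [bexp 0] is smooth. *)
Definition bexp j x : R := if 0 < x then x^-1 ^+ j * expR (- x^-1) else 0.

Lemma bexp_ge0 j x : 0 <= bexp j x.
Proof.
by rewrite /bexp; case: ifP => // x0; rewrite mulr_ge0 ?expR_ge0// exprn_ge0// invr_ge0
    ltW.
Qed.

Lemma bexp_le0 j x : x <= 0 -> bexp j x = 0.
Proof. by rewrite /bexp ltNge => ->. Qed.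

Lemma bexp0_gt0 x : 0 < x -> bexp 0 x = expR (- x^-1).
Proof. by rewrite /bexp => ->; rewrite mul1r. Qed.

(** The exponential of 1/x dominates its Taylor term of degree j + m + 1. The free parameter m
    measures flatness at 0; the derivative there takes m = 1. *)
Lemma bexp_le j m x : 0 < x -> bexp j x <= (j + m).+1`!%:R * x ^+ m.+1.
Proof.
move=> x0; rewrite /bexp x0 expRN -ler_pdivlMr ?invr_gt0 ?expR_gt0// invrK.
have xV0 : 0 <= x^-1 by rewrite invr_ge0 ltW.
have := expR_ge1Dxn (j + m) xV0.
set N := (_`!%:R); move=> h.
have N0 : 0 < N by rewrite ltr0n fact_gt0.
have {}h : x^-1 ^+ (j + m).+1 / N <= expR x^-1 by lra.
rewrite -mulrA [X in _ <= _ * X]mulrC mulrA -ler_pdivrMr ?exprn_gt0//.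
rewrite mulrC in h; rewrite -ler_pdivrMl// (le_trans _ h)// ler_pM2l ?invr_gt0//.
by rewrite -exprVn -exprD addnS.
Qed.

Lemma bexp0_le1 x : bexp 0 x <= 1.
Proof.
rewrite /bexp; case: ifP => // x0; rewrite mul1r.
by rewrite -expR0 ler_expR oppr_le0 invr_ge0 ltW.
Qed.

(** [bexp 2] is the derivative of [bexp 0], so this bounds the slope of the cutoff profile. *)
Lemma bexp2_le x : bexp 2 x <= 2.
Proof.
have [x0|x0] := leP x 0; first by rewrite bexp_le0.
rewrite /bexp x0 expRN -ler_pdivlMr ?invr_gt0 ?expR_gt0// invrK.
have xV0 : 0 <= x^-1 by rewrite invr_ge0 ltW.
have := expR_ge1Dxn 1 xV0; rewrite (_ : 2`! = 2)%N//; lra.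
Qed.

Lemma is_derive_bexp j x :
  is_derive x 1 (bexp j) (bexp j.+2 x - j%:R * bexp j.+1 x).
Proof.
have [x0|x0|->] := ltgtP x 0.
- rewrite !bexp_le0 ?ltW// mulr0 subr0.
  apply: (@near_eq_is_derive _ _ _ (cst 0)) => //.
  near=> y; rewrite /cst bexp_le0// ltW//; near: y; exact: lt_nbhsl.
- apply: (@near_eq_is_derive _ _ _ (fun x => x^-1 ^+ j * expR (- x^-1))).
    near=> y; rewrite /bexp ifT//; near: y; exact: lt_nbhsr.
  rewrite /bexp x0.
  have xn0 : x != 0 by rewrite gt_eqF.
  have dV : is_derive x 1 (fun x : R => x^-1) (- x ^- 2 *: 1).
    by apply: (@is_deriveV _ id).
  have dj := is_deriveX j dV.
  have dN := is_deriveN dV.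
  have de := @is_derive1_comp _ expR (fun x => - x^-1) x _ _ (is_derive_expR (- x^-1))
      dN.
  have := is_deriveM dj de.
  rewrite (_ : _ * _ = (fun x => x^-1 ^+ j * expR (- x^-1))); last by apply/funext => y;
      rewrite !fctE.
  move=> H; apply: (is_derive_eq H); rewrite /= /GRing.scale/= mulr1.
  case: j {dj H} => [|j]; first by rewrite !fctE !mul0r expr0; field.
  rewrite /= -!exprVn !fctE; set y := x^-1; set z := expR _; rewrite !exprS; ring.
- rewrite !bexp_le0 ?mulr0 ?subr0//.
  have h : h^-1 *: (bexp j (h *: 1 + 0) - bexp j 0) @[h --> (0 : R)^'] --> (0 : R).
    apply/cvgr0Pnorm_lt => e e0.
    pose C : R := (j + 1).+1`!%:R.
    (* At 0 the difference quotient vanishes for h < 0 and is at most C h for h > 0. *)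
    have C0 : 0 < C by rewrite ltr0n fact_gt0.
    near=> h; rewrite (bexp_le0 j (lexx 0)) subr0 /GRing.scale/= mulr1 addr0.
    have h0 : h != 0 by near: h; exact: nbhs_dnbhs_neq.
    have [hn|hp] := leP h 0; first by rewrite bexp_le0// mulr0 normr0.
    rewrite ger0_norm ?mulr_ge0 ?bexp_ge0 ?invr_ge0 1?ltW//.
    have hC : `|h| < e / C.
      near: h; apply: dnbhs0_lt; exact: divr_gt0.
    have := bexp_le j 1 hp; rewrite -/C => hh.
    rewrite ltr_pdivrMl// (le_lt_trans hh)//.
    move: hC; rewrite gtr0_norm// ltr_pdivlMr// => hC; rewrite expr2; nra.
  apply: DeriveDef; first by apply/cvg_ex; exists 0.
  exact/cvg_lim.
Unshelve. all: end_near. Qed.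

Lemma continuous_bexp j : continuous (bexp j).
Proof.
move=> x; apply: differentiable_continuous; apply/derivable1_diffP.
by have [] := is_derive_bexp j x.
Qed.

End bexp.

Section smooth.
Context {R : realType} {d : nat}.
Implicit Types (f g p phi : 'rV[R]_d -> R) (x v : 'rV[R]_d).

(** Directional derivatives are turned into derivatives in one real variable, where the chain rule
    for real functions applies. *)
Lemma is_derive_line (V : normedModType R) (f : V -> R) (x v : V) df :
  is_derive x v f df <-> is_derive (0 : R) (1 : R) (fun h => f (h *: v + x)) df.
Proof.
have e : (fun h : R => h^-1 *: ((f \o shift x) (h *: v) - f x)) =
   (fun h => h^-1 *: (((fun h => f (h *: v + x)) \o shift 0) (h *: 1) - f (0 *:
       v + x))).
  by apply/funext => h /=; rewrite scale0r add0r addr0 [h *: 1]mulr1.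
split=> -[D E]; apply: DeriveDef.
- by move: D; rewrite /derivable e.
- by rewrite -E /derive e.
- by rewrite /derivable e.
- by rewrite -E /derive e.
Qed.

Lemma is_derive_comp_dir (g : R -> R) p x v a b :
  is_derive (p x) 1 g a -> is_derive x v p b ->
  is_derive x v (fun y => g (p y)) (a * b).
Proof.
move=> ga /is_derive_line pb; apply/is_derive_line.
by apply: (is_derive1_comp (f := g)) => //; rewrite scale0r add0r.
Qed.

Lemma is_derive_coord x v i :
  is_derive x v (fun y : 'rV[R]_d => y 0 i) (v 0 i).
Proof.
apply/is_derive_line; under eq_fun do rewrite !mxE.
have := is_deriveD (is_deriveM (is_derive_id (0:R) 1) (is_derive_cst (v 0 i) (0:R) 1))
    (is_derive_cst (x 0 i) (0:R) (1 : R)).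
move=> H; apply: (is_derive_eq H).
by rewrite /GRing.scale/= !mul0r !mulr1 !add0r addr0.
Qed.

Lemma class_CS k f : class_C k.+1 f -> class_C k f.
Proof.
elim: k f => [|k ih] f; first by case.
case=> cf df; split => // i; have [h1 h2] := df i; split => //; exact: ih.
Qed.

Lemma class_C_continuous k f : class_C k f -> continuous f.
Proof. by case: k => [|k] []. Qed.

Lemma class_C_derive k f (df : 'I_d -> 'rV[R]_d -> R) : continuous f ->
  (forall i x, is_derive x (delta_mx 0 i) f (df i x)) ->
  (forall i, class_C k (df i)) -> class_C k.+1 f.
Proof.
move=> cf fd Cdf; split => // i; split => [x|]; first by have [] := fd i x.
rewrite (_ : partial_derive i f = df i)//; apply/funext => x.
by have [] := fd i x.
Qed.

Lemma class_C_deriveP k f : class_C k.+1 f -> forall i x,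
  is_derive x (delta_mx 0 i) f (partial_derive i f x).
Proof. by move=> [_ h] i x; have [h1 _] := h i; exact: derivableP. Qed.

Lemma class_C_cst k (a : R) : class_C k (fun _ : 'rV[R]_d => a).
Proof.
elim: k a => [|k ih] a; first by split => //; exact: cst_continuous.
apply: (@class_C_derive _ _ (fun _ _ => 0)) => [|i]; last exact: ih.
exact: cst_continuous.
Qed.

Lemma class_C_coord k i : class_C k (fun y : 'rV[R]_d => y 0 i).
Proof.
case: k => [|k]; first by split => //; exact: coord_continuous.
apply: (@class_C_derive _ _ (fun j _ => (delta_mx 0 j : 'rV[R]_d) 0 i)) => [|j x|j].
- exact: coord_continuous.
- exact: is_derive_coord.
- exact: class_C_cst.
Qed.

Lemma class_CD k f g : class_C k f -> class_C k g ->
  class_C k (fun x => f x + g x).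
Proof.
have cD (f' g' : 'rV[R]_d -> R) : continuous f' -> continuous g' -> continuous (fun x :
    'rV[R]_d => f' x + g' x : R).
  by move=> cf cg x; apply: (@continuousD _ _ _ f' g'); [exact: cf|exact: cg].
elim: k f g => [|k ih] f g Cf Cg.
  by split => //; apply: cD; [case: Cf|case: Cg].
apply: (@class_C_derive _ _ (fun i x => partial_derive i f x + partial_derive i g x)) =>
    [|i x|i].
- by apply: cD; [case: Cf|case: Cg].
- exact: (is_deriveD (class_C_deriveP Cf i x) (class_C_deriveP Cg i x)).
- by apply: ih; [case: Cf => _ /(_ i)[]|case: Cg => _ /(_ i)[]].
Qed.

Lemma class_CM k f g : class_C k f -> class_C k g ->
  class_C k (fun x => f x * g x).
Proof.
have cM (f' g' : 'rV[R]_d -> R) : continuous f' -> continuous g' -> continuous (fun x :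
    'rV[R]_d => f' x * g' x : R).
  by move=> cf cg x; apply: (@continuousM _ _ f' g'); [exact: cf|exact: cg].
elim: k f g => [|k ih] f g Cf Cg.
  by split => //; apply: cM; [case: Cf|case: Cg].
apply: (@class_C_derive _ _ (fun i x => f x * partial_derive i g x + g x *
    partial_derive i f x)) => [|i x|i].
- by apply: cM; [case: Cf|case: Cg].
- exact: (is_deriveM (class_C_deriveP Cf i x) (class_C_deriveP Cg i x)).
- apply: class_CD; apply: ih; try exact: class_CS.
    by case: Cg => _ /(_ i)[].
  by case: Cf => _ /(_ i)[].
Qed.

Lemma class_C_sum k m (F : 'I_m -> 'rV[R]_d -> R) : (forall i, class_C k (F i)) ->
  class_C k (fun x => \sum_(i < m) F i x).
Proof.
elim: m F => [|m ih] F CF.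
  by under eq_fun do rewrite big_ord0; exact: class_C_cst.
under eq_fun do rewrite big_ord_recr/=.
by apply: class_CD => //; exact: ih.
Qed.

Lemma class_C_bexp k j p : class_C k p -> class_C k (fun x => bexp j (p x)).
Proof.
have cB i (q : 'rV[R]_d -> R) : continuous q -> continuous (fun x : 'rV[R]_d =>
    bexp i (q x)).
  move=> cq x; apply: (@continuous_comp _ _ _ q (bexp i)); first exact: cq.
  exact: continuous_bexp.
elim: k j p => [|k ih] j p Cp.
  by split => //; apply: cB; case: Cp.
apply: (@class_C_derive _ _ (fun i x => (bexp j.+2 (p x) + (- j%:R) * bexp j.+1 (p x)) *
    partial_derive i p x)) => [|i x|i].
- by apply: cB; case: Cp.
- rewrite mulNr; apply: is_derive_comp_dir; first exact: is_derive_bexp.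
  exact: (class_C_deriveP Cp).
- apply: class_CM; last by case: Cp => _ /(_ i)[].
  apply: class_CD; first by apply: ih; exact: class_CS.
  apply: class_CM; first exact: class_C_cst.
  by apply: ih; exact: class_CS.
Qed.

End smooth.

(** [level] is a quadratic polynomial both along a line in space and in time, so this serves both
    derivatives of the cutoff. *)
Lemma is_derive_quadratic (R : realType) (a b c : R) :
  is_derive (0 : R) (1 : R) (fun h : R => a + h * b + h ^+ 2 * c) b.
Proof.
have H := is_deriveD (is_deriveD (is_derive_cst a (0 : R) (1 : R))
  (is_deriveM (is_derive_id (0 : R) 1) (is_derive_cst b (0 : R) 1)))
  (is_deriveM (is_deriveX 2 (is_derive_id (0 : R) 1)) (is_derive_cst c (0 : R) 1)).
apply: (is_derive_eq H).
by rewrite /GRing.scale/= !(mul0r, mulr0, mulr1, add0r, addr0).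
Qed.

(** * Integrability on cubes *)

Section sup_ball.
Context {R : realType} {d : nat}.
Implicit Types rho : R.

Definition sup_ball rho : set 'rV[R]_d := [set w | `|w| <= rho].

Lemma closed_sup_ball rho : closed (sup_ball rho).
Proof.
rewrite (_ : sup_ball rho = (fun w : 'rV[R]_d => `|w|) @^-1` [set y | y <= rho])//.
apply: preimage_closed; last exact: closed_le.
by move=> w _; exact: norm_continuous.
Qed.

Lemma compact_sup_ball rho : compact (sup_ball rho).
Proof.
apply: bounded_closed_compact; last exact: closed_sup_ball.
exists rho; split; first exact: num_real.
by move=> y ry w /= wr; rewrite (le_trans wr)// ltW.
Qed.

Lemma measurable_sup_ball rho : measurable (sup_ball rho).
Proof.
rewrite -(setCK (sup_ball rho)); apply: measurableC; apply: open_measurable_rV.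
exact/closed_openC/closed_sup_ball.
Qed.

Lemma mem_sup_ball rho (w : 'rV[R]_d) : 0 <= rho -> (forall i, `|w 0 i| <= rho) ->
    sup_ball rho w.
Proof.
move=> rho0 h; rewrite /sup_ball/= /Num.norm/= mx_normrE.
by apply/bigmax_leP; split => // -[i j] _ /=; rewrite ord1.
Qed.

Lemma test_function_sup_ball rho (phi : 'rV[R]_d -> R) :
  (forall k, class_C k phi) -> (forall w, phi w != 0 -> sup_ball rho w) ->
  test_function phi.
Proof.
move=> Cphi sphi; split => //; apply: (@subclosed_compact _ _ (sup_ball rho)).
- exact: closed_closure.
- exact: compact_sup_ball.
rewrite [X in _ `<=` X](closure_id _).1; last exact: closed_sup_ball.
by apply: closure_subset => w /=; exact: sphi.
Qed.

Local Notation mu := (lebesgue_rV R d).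

Lemma L1_loc_integrable (u : 'rV[R]_d -> R) rho : L1_loc u ->
    mu.-integrable (sup_ball rho) (EFin \o u).
Proof.
move=> [mu_ iu]; apply/integrableP; split; last by have := iu _ (@compact_sup_ball rho).
by apply/measurable_EFinP; exact: measurable_funTS.
Qed.

Lemma L1_locM_integrable (u h : 'rV[R]_d -> R) rho : L1_loc u ->
  continuous h ->
  mu.-integrable (sup_ball rho) (fun w => (u w * h w)%:E).
Proof.
move=> iu ch; apply: (@integrableMl _ _ _ _ _ (measurable_sup_ball rho) (EFin \o u) h).
- exact: L1_loc_integrable.
- by apply: measurable_funTS; exact: continuous_measurable_rV.
- have : bounded_set (h @` sup_ball rho).
    apply: compact_bounded; apply: continuous_compact; last exact: compact_sup_ball.
    by apply: continuous_subspaceT.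
  move=> [M [Mr hM]]; exists M; split => // y yM w wK /=.
  by apply: (hM _ yM) => /=; exists w.
Qed.

Lemma Rintegral_sup_ball rho (h : 'rV[R]_d -> R) :
  (forall w, ~ sup_ball rho w -> h w = 0) ->
  (\int[mu]_w h w = \int[mu]_(w in sup_ball rho) h w)%R.
Proof.
move=> h0; rewrite [RHS]Rintegral_mkcond; congr Rintegral.
by apply/funext => w; rewrite patchE; case: ifPn => //; rewrite notin_setE => /h0.
Qed.

Lemma Rintegral_sum m (D : set 'rV[R]_d) (F : 'I_m -> 'rV[R]_d -> R) : measurable D ->
  (forall i, mu.-integrable D (EFin \o F i)) ->
  (\sum_(i < m) \int[mu]_(w in D) F i w = \int[mu]_(w in D) \sum_(i < m) F i w)%R.
Proof.
move=> mD; elim: m F => [|m ih] F iF.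
  rewrite big_ord0; under eq_Rintegral do rewrite big_ord0.
  by rewrite Rintegral_cst// mul0r.
rewrite big_ord_recr/= ih//; under [RHS]eq_Rintegral do rewrite big_ord_recr/=.
rewrite RintegralD//.
rewrite (_ : _ \o _ = (fun w => \sum_(i < m) (F (widen_ord (leqnSn m) i) w)%:E)%E).
  by apply: integrable_sum => // i _; exact: (iF (widen_ord (leqnSn m) i)).
by apply/funext => w /=; rewrite sumEFin.
Qed.

End sup_ball.

(** * Integrals over a moving ball *)

Section moving_ball.
Context {R : realType} {d : nat}.
Variables (c r : R) (v z : 'rV[R]_d).
Hypothesis r_gt0 : 0 < r.
Implicit Types (w : 'rV[R]_d) (t : R) (N : nat).
Local Notation mu := (lebesgue_rV R d).

Definition field w : 'rV[R]_d := c *: w + v.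
Definition flow t w : 'rV[R]_d := w + t *: field w.
(* The cutoffs tend to the indicator of the preimage of B(z, r) under the flow. *)
Definition level N t w : R :=
  N%:R * (r ^+ 2 - dotp (flow t w - z) (flow t w - z)).
Definition cutoff N t w : R := bexp 0 (level N t w).

(** If |t| < 1 and [flow t w] lies in B(z, r), each coordinate of (1 + c t) w is at most r + |v| +
    |z| in absolute value; the factor 2 comes from 1 + c t >= 1/2. *)
Definition flow_radius : R := 2 * (r + enorm v + enorm z).
Local Notation K := (@sup_ball R d flow_radius).

(* For such t the flow is invertible and the cutoffs live in one fixed compact set. *)
Definition admissible t := `|t| < (2 * (1 + `|c|))^-1.

Lemma admissible_lt t : admissible t -> `|t| < 1 /\ `|c * t| < 2^-1.
Proof.
rewrite /admissible; have c0 := normr_ge0 c; have t0 := normr_ge0 t.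
rewrite normrM -div1r ltr_pdivlMr; last lra.
move: `|c| `|t| c0 t0 => C T *; split; nra.
Qed.

Lemma admissible_gt0 t : admissible t -> 0 < 1 + c * t.
Proof. by move=> /admissible_lt[_]; rewrite ltr_norml => /andP[h _]; lra. Qed.

Lemma admissible_le s t : admissible t -> `|s| <= `|t| -> admissible s.
Proof. by move=> at_ /le_lt_trans; apply. Qed.

Lemma admissible0 : admissible 0.
Proof. by rewrite /admissible normr0 invr_gt0 mulr_gt0// ltr_pwDl. Qed.

Lemma flowE t w : flow t w = (1 + c * t) *: w + t *: v.
Proof. by apply/rowP => i; rewrite /flow /field !mxE; ring. Qed.

Lemma level_gt0 N t w : 0 < level N t w -> enorm (flow t w - z) < r.
Proof.
rewrite enorm_lt// /level => h.
have : 0 < N%:R :> R by rewrite lt_neqAle ler0n andbT eq_sym; apply/eqP => N0; move: h;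
    rewrite N0 mul0r ltxx.
by move=> N0; rewrite -subr_gt0 -(pmulr_rgt0 _ N0).
Qed.

Lemma flow_bounded t w : admissible t -> enorm (flow t w - z) < r -> K w.
Proof.
move=> at_ h; have [t1 ct] := admissible_lt at_.
have v0 := enorm_ge0 v; have z0 := enorm_ge0 z.
apply: mem_sup_ball; first by rewrite /flow_radius mulr_ge0 ?addr_ge0 // ltW.
move=> i; have := le_lt_trans (coord_le_enorm _ i) h.
rewrite flowE !mxE; have := coord_le_enorm v i; have := coord_le_enorm z i.
move: (v 0 i) (z 0 i) (w 0 i) => vi zi wi zi_le vi_le h1.
have h2 : `|t * vi| <= enorm v.
  by rewrite normrM -[leRHS]mul1r ler_pM// ltW.
have h3 : 2^-1 * `|wi| <= `|(1 + c * t) * wi|.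
  rewrite normrM ler_wpM2r// gtr0_norm ?admissible_gt0//.
  by move: ct; rewrite ltr_norml => /andP[? _]; lra.
have h4 : `|(1 + c * t) * wi| <= `|(1 + c * t) * wi + t * vi - zi| + `|t * vi| + `|zi|.
  rewrite {1}(_ : (1 + c * t) * wi = ((1 + c * t) * wi + t * vi - zi) - t * vi + zi);
      last by ring.
  by rewrite (le_trans (ler_normD _ _))// lerD2r ler_normB.
rewrite /flow_radius; lra.
Qed.

Lemma cutoff_out N t w j : admissible t -> ~ K w -> bexp j (level N t w) = 0.
Proof.
move=> at_ nK; apply: bexp_le0; rewrite leNgt; apply/negP => /level_gt0.
by move=> /(flow_bounded at_).
Qed.

Lemma class_C_field k i : class_C k (fun w => field w 0 i).
Proof.
rewrite (_ : (fun _ => _) = (fun w : 'rV[R]_d => c * w 0 i + v 0 i)); last first.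
  by apply/funext => w; rewrite !mxE.
apply: class_CD; last exact: class_C_cst.
by apply: class_CM; [exact: class_C_cst|exact: class_C_coord].
Qed.

Lemma class_C_level k N t : class_C k (level N t).
Proof.
rewrite (_ : level N t = (fun w : 'rV[R]_d => N%:R * (r ^+ 2 + (-1) *
   \sum_(i < d) (w 0 i + t * field w 0 i + - z 0 i) * (w 0 i + t * field w 0 i + - z 0
       i)))); last first.
  apply/funext => w; rewrite /level mulN1r; congr (_ * (_ - _)).
  by apply: eq_bigr => i _; rewrite !mxE.
apply: class_CM; first exact: class_C_cst.
apply: class_CD; first exact: class_C_cst.
apply: class_CM; first exact: class_C_cst.
apply: class_C_sum => i.
suff h : class_C k (fun w : 'rV[R]_d => w 0 i + t * field w 0 i + - z 0 i) by exact:
    class_CM.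
apply: class_CD; last exact: class_C_cst.
apply: class_CD; first exact: class_C_coord.
by apply: class_CM; [exact: class_C_cst|exact: class_C_field].
Qed.

Lemma class_C_cutoff k N t : class_C k (cutoff N t).
Proof. by apply: class_C_bexp; exact: class_C_level. Qed.

Lemma cutoff_ge0 N t w : 0 <= cutoff N t w. Proof. exact: bexp_ge0. Qed.
Lemma cutoff_le1 N t w : cutoff N t w <= 1. Proof. exact: bexp0_le1. Qed.

Lemma test_function_cutoff N t i : admissible t ->
  test_function (fun w => cutoff N t w * field w 0 i).
Proof.
move=> at_; apply: (@test_function_sup_ball _ _ flow_radius).
  by move=> k; apply: class_CM; [exact: class_C_cutoff|exact: class_C_field].
move=> w; apply: contraNP => nK; rewrite /cutoff (cutoff_out _ _ at_ nK).
by rewrite mul0r.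
Qed.

Lemma is_derive_cutoff0 (p : R -> R) s l : is_derive s (1:R) p l ->
  is_derive s (1:R) (fun h => bexp 0 (p h)) (bexp 2 (p s) * l).
Proof.
move=> pl; apply: is_derive1_comp => //.
by apply: (is_derive_eq (is_derive_bexp 0 (p s))); rewrite mul0r subr0.
Qed.

Lemma is_derive_cutoff_space N t w i :
  is_derive w (delta_mx 0 i) (cutoff N t)
    (bexp 2 (level N t w) * (- 2 * N%:R * (1 + c * t) * (flow t w - z) 0 i)).
Proof.
apply/is_derive_line.
set e := delta_mx 0 i.
have -> : (fun h => cutoff N t (h *: e + w)) = (fun h => bexp 0 (level N t w
   + h * (- 2 * N%:R * (1 + c * t) * (flow t w - z) 0 i)
   + h ^+ 2 * (- N%:R * (1 + c * t) ^+ 2 * dotp e e))).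
  apply/funext => h; congr bexp; rewrite /level.
  rewrite (_ : flow t (h *: e + w) - z = (flow t w - z) + (h * (1 + c * t)) *: e);
      last first.
    by apply/rowP => j; rewrite !flowE !mxE; ring.
  rewrite -(dotp_delta (flow t w - z) i) -/e.
  move: (flow t w - z) => y; move: @e => e.
  rewrite !(dotpDl, dotpDr, dotpZl, dotpZr) (dotpC e y); ring.
have := is_derive_cutoff0 (is_derive_quadratic (level N t w)
  (- 2 * N%:R * (1 + c * t) * (flow t w - z) 0 i) (- N%:R * (1 + c * t) ^+ 2 * dotp e
      e)).
by rewrite mul0r expr0n/= mul0r !addr0.
Qed.

Definition cutoff_dt N t w : R :=
  bexp 2 (level N t w) * (- 2 * N%:R * dotp (flow t w - z) (field w)).

Lemma is_derive_cutoff_time N t w :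
  is_derive t (1 : R) (fun s => cutoff N s w) (cutoff_dt N t w).
Proof.
apply/is_derive_line.
have -> : (fun h => cutoff N (h *: (1 : R) + t) w) = (fun h => bexp 0 (level N t w
   + h * (- 2 * N%:R * dotp (flow t w - z) (field w))
   + h ^+ 2 * (- N%:R * dotp (field w) (field w)))).
  apply/funext => h; congr bexp; rewrite /level.
  rewrite (_ : flow (h *: (1:R) + t) w - z = (flow t w - z) + h *: field w); last first.
    by apply/rowP => j; rewrite /flow !mxE; rewrite [h *: _]mulr1; ring.
  move: (flow t w - z) (field w) => y e.
  rewrite !(dotpDl, dotpDr, dotpZl, dotpZr) (dotpC e y); ring.
have := is_derive_cutoff0 (is_derive_quadratic (level N t w)
  (- 2 * N%:R * dotp (flow t w - z) (field w)) (- N%:R * dotp (field w) (field w))).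
by rewrite mul0r expr0n/= mul0r !addr0.
Qed.

End moving_ball.

Section cutoff_weak_gradient.
Context {R : realType} {d : nat}.
Variables (c r : R) (v z : 'rV[R]_d).
Hypothesis r_gt0 : 0 < r.
Implicit Types (w : 'rV[R]_d) (t : R) (N : nat).
Local Notation mu := (lebesgue_rV R d).
Local Notation K := (@sup_ball R d (flow_radius r v z)).
Local Notation admissible := (admissible c).
Local Notation field := (field c v).
Local Notation flow := (flow c v).
Local Notation level := (level c r v z).
Local Notation cutoff := (cutoff c r v z).
Local Notation cutoff_dt := (cutoff_dt c r v z).

Let mK : measurable K. Proof. exact: measurable_sup_ball. Qed.

(** The summand of index i of [cutoff_dt]. Multiplied by 1 + c t it is the i-th partial derivative
    of the cutoff times the i-th component of [field]: this is how a time derivative becomes a space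
    derivative. *)
Let da N t i w : R := bexp 2 (level N t w) * (- 2 * N%:R * (flow t w - z) 0 i) * field w
    0 i.

Let class_C_da k N t i : class_C k (da N t i).
Proof.
apply: class_CM; last exact: class_C_field.
apply: class_CM; first by apply: class_C_bexp; exact: class_C_level.
apply: class_CM; first exact: class_C_cst.
rewrite (_ : (fun _ => _) = (fun w : 'rV[R]_d => w 0 i + t * field w 0 i + - z 0 i));
    last first.
  by apply/funext => w; rewrite !mxE.
apply: class_CD; last exact: class_C_cst.
apply: class_CD; first exact: class_C_coord.
by apply: class_CM; [exact: class_C_cst|exact: class_C_field].
Qed.

Let cutoff_dtE N t w : cutoff_dt N t w = \sum_(i < d) da N t i w.
Proof.
rewrite /cutoff_dt /dotp !mulr_sumr; apply: eq_bigr => i _; rewrite /da; ring.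
Qed.

Let continuous_cutoff N t : continuous (cutoff N t).
Proof. exact: (class_C_continuous (class_C_cutoff c r v z 0 N t)). Qed.

Let continuous_da N t i : continuous (da N t i).
Proof. exact: (class_C_continuous (class_C_da 0 N t i)). Qed.

Lemma continuous_field : continuous field.
Proof.
by apply: continuous_rV => i; exact: (class_C_continuous (class_C_field c v 0 i)).
Qed.

Lemma continuous_field_coord i : continuous (fun w => field w 0 i).
Proof. exact: (class_C_continuous (class_C_field c v 0 i)). Qed.

(* The test functions are the components of cutoff * field; div field = c d. *)
Lemma weak_gradient_cutoff u G N t : L1_loc u -> is_weak_gradient u G -> admissible t ->
  (1 + c * t) * (\int[mu]_(w in K) (u w * cutoff_dt N t w))%R =
  - (\int[mu]_(w in K) (dotp (G w) (field w) * cutoff N t w))%R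
  - c * d%:R * (\int[mu]_(w in K) (u w * cutoff N t w))%R.
Proof.
move=> iu uG at_.
have iKM (f h : 'rV[R]_d -> R) : L1_loc f -> continuous h ->
  mu.-integrable K (fun w => (f w * h w)%:E) by exact: L1_locM_integrable.
have outK w j : ~ K w -> bexp j (level N t w) = 0 by exact: cutoff_out.
have key i : (1 + c * t) * (\int[mu]_(w in K) (u w * da N t i w))%R
   + c * (\int[mu]_(w in K) (u w * cutoff N t w))%R
   = - (\int[mu]_(w in K) (G w 0 i * (cutoff N t w * field w 0 i)))%R.
  have [iG /(_ _ (test_function_cutoff v z r_gt0 N i at_)) wG] := uG i.
  have dE w : partial_derive i (fun w => cutoff N t w * field w 0 i) w =
      (1 + c * t) * da N t i w + c * cutoff N t w.
    have H := is_deriveM (is_derive_cutoff_space c r v z N t w i)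
      (is_deriveD (is_deriveZ c (is_derive_coord w (delta_mx 0 i) i)) (is_derive_cst (v
          0 i) w (delta_mx 0 i))).
    rewrite /partial_derive.
    rewrite (_ : (fun w0 => _) = cutoff N t * (c \*: (fun y : 'rV[R]_d =>
        y 0 i) + cst (v 0 i))); last first.
      by apply/funext => y; rewrite /field !mxE.
    rewrite (@derive_val _ _ _ _ _ _ _ H) /GRing.scale/= !mxE !eqxx /da /field !mxE
        !fctE/= /GRing.scale/=; ring.
  rewrite (Rintegral_sup_ball (rho := flow_radius r v z)) in wG; last first.
    by move=> w nK; rewrite dE /da /cutoff !outK// !mul0r !mulr0 addr0 mulr0.
  rewrite (Rintegral_sup_ball (rho := flow_radius r v z)) in wG; last first.
    by move=> w nK; rewrite /cutoff outK// mul0r mulr0.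
  rewrite -wG -!RintegralZl//; [|exact: iKM..].
  rewrite -RintegralD//; last 2 first.
    rewrite (_ : _ \o _ = (fun w => ((1 + c * t)%:E * (u w * da N t i w)%:E)%E)).
      by apply: integrableZl => //; exact: iKM.
    by [].
    rewrite (_ : _ \o _ = (fun w => ((c)%:E * (u w * cutoff N t w)%:E)%E)).
      by apply: integrableZl => //; exact: iKM.
    by [].
  by apply: eq_Rintegral => w _; rewrite dE; ring.
have icfg i : mu.-integrable K (fun w => (G w 0 i * (cutoff N t w * field w 0 i))%:E).
  have [iG _] := uG i.
  apply: iKM => // w; apply: (@continuousM _ _ (cutoff N t) (fun w => field w 0 i)).
    exact: continuous_cutoff.
  exact: continuous_field_coord.
transitivity (\sum_(i < d) ((1 + c * t) * (\int[mu]_(w in K) (u w * da N t i w))%R)).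
  rewrite -mulr_sumr Rintegral_sum//; last by move=> i; exact: iKM.
  congr (_ * _); apply: eq_Rintegral => w _.
  by rewrite cutoff_dtE mulr_sumr.
have -> : (\int[mu]_(w in K) (dotp (G w) (field w) * cutoff N t w))%R =
   \sum_(i < d) (\int[mu]_(w in K) (G w 0 i * (cutoff N t w * field w 0 i)))%R.
  rewrite Rintegral_sum//; apply: eq_Rintegral => w _.
  by rewrite /dotp mulr_suml; apply: eq_bigr => i _; ring.
rewrite -sumrN -mulrA mulrCA mulr_natl -[X in _ *+ X](card_ord d) -sumr_const -sumrB.
by apply: eq_bigr => i _; rewrite -key addrK.
Qed.

End cutoff_weak_gradient.

(** * Limits of the smoothed integrals *)

Section cutoff_limit.
Context {R : realType} {d : nat}.
Variables (c r : R) (v z : 'rV[R]_d).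
Hypothesis r_gt0 : 0 < r.
Implicit Types (w : 'rV[R]_d) (t : R) (N : nat).
Local Notation mu := (lebesgue_rV R d).
Local Notation K := (@sup_ball R d (flow_radius r v z)).
Local Notation admissible := (admissible c).
Local Notation field := (field c v).
Local Notation flow := (flow c v).
Local Notation level := (level c r v z).
Local Notation cutoff := (cutoff c r v z).
Local Notation cutoff_dt := (cutoff_dt c r v z).

Let mK : measurable K. Proof. exact: measurable_sup_ball. Qed.

(** For admissible t, the preimage of B(z, r) under [flow t]. It is a ball because [flow t] is a
    homothety followed by a translation. *)
Definition flow_ball t : set 'rV[R]_d :=
  eball ((1 + c * t)^-1 *: (z - t *: v)) (r / (1 + c * t)).

Lemma flow_centerE t w : admissible t ->
  enorm (flow t w - z) = (1 + c * t) * enorm (w - (1 + c * t)^-1 *: (z - t *: v)).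
Proof.
move=> /admissible_gt0 ct; rewrite -[X in X * enorm _](gtr0_norm ct) -enormZ;
    congr enorm.
rewrite scalerBr scalerA mulfV ?gt_eqF// scale1r flowE.
by apply/rowP => i; rewrite !mxE; ring.
Qed.

Lemma flow_ballP t w : admissible t -> flow_ball t w <-> enorm (flow t w - z) < r.
Proof.
move=> at_; rewrite /flow_ball /eball/= flow_centerE//.
by rewrite ltr_pdivlMr ?admissible_gt0// mulrC.
Qed.

Lemma flow_ball_sub t : admissible t -> flow_ball t `<=` K.
Proof. by move=> at_ w /(flow_ballP _ at_); exact: flow_bounded. Qed.

Lemma flow_sphereE t : admissible t -> [set w | enorm (flow t w - z) = r] =
  [set w : 'rV[R]_d | enorm (w - (1 + c * t)^-1 *: (z - t *: v)) = r / (1 + c * t)].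
Proof.
move=> at_; have ct := admissible_gt0 at_.
apply/seteqP; split => w /=; rewrite flow_centerE// => h.
  by rewrite -h mulrAC mulfV ?mul1r ?gt_eqF.
by rewrite h mulrCA mulfV ?mulr1 ?gt_eqF.
Qed.

Lemma continuous_flow w : continuous (fun t => flow t w - z).
Proof.
apply: continuous_rV => i; under eq_fun do rewrite !mxE.
move=> t; apply: (@continuousB _ _ _ (fun t => w 0 i + t * (c * w 0 i + v 0 i)) (cst (z
    0 i))).
  apply: (@continuousD _ _ _ (cst (w 0 i)) (fun t => t * (c * w 0 i + v 0 i))).
    exact: cst_continuous.
  apply: (@continuousM _ _ id (cst (c * w 0 i + v 0 i))); first exact: cvg_id.
  exact: cst_continuous.
exact: cst_continuous.
Qed.

Section sequence.
Variables (n_ : nat -> nat) (xi : R^nat) (s : R).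
Hypothesis le_n : forall m, (m <= n_ m)%N.
Hypothesis xi_s : xi @ \oo --> s.

(** Index and time move together, since the mean value theorem will supply a different time for each
    index. Points of the limiting sphere are excluded because the sign of [level] is not controlled
    there. *)
Lemma cutoff_cvg w : enorm (flow s w - z) != r ->
  cutoff (n_ m) (xi m) w @[m --> \oo] --> (if enorm (flow s w - z) < r then 1 else 0 :
      R).
Proof.
move=> qr.
pose a t := r ^+ 2 - dotp (flow t w - z) (flow t w - z).
have a_s : a (xi m) @[m --> \oo] --> a s.
  apply: cvgB; first exact: cvg_cst.
  apply: (@cvg_comp _ _ _ xi (fun t => dotp (flow t w - z) (flow t w - z)) _ (nbhs s))
      => //.
  exact: (dotp_continuous (@continuous_flow w) (@continuous_flow w)).
have lE m : level (n_ m) (xi m) w = (n_ m)%:R * a (xi m) by [].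
have [h|h|/eqP] := ltgtP (enorm (flow s w - z)) r; last by rewrite (negbTE qr).
- have as0 : 0 < a s by rewrite subr_gt0 -enorm_lt.
  apply/cvgrPdist_lt => e e0; near=> m.
  have am : a s / 2 < a (xi m).
    near: m; apply: (cvgr_gt (a s)) => //; lra.
  (* With [a (xi m)] above [a s / 2], this makes the level exceed 1/e; then 1 - exp (-1/level) <=
     1/level < e. *)
  have mR : 2 / (a s * e) < m%:R by near: m; exact: nbhs_infty_gtr.
  have nm : m%:R <= (n_ m)%:R :> R by rewrite ler_nat.
  have m0 : 0 < 2 / (a s * e) by rewrite divr_gt0// mulr_gt0.
  have na0 : 0 < (n_ m)%:R * a (xi m) by nra.
  rewrite ger0_norm ?subr_ge0 ?cutoff_le1// /cutoff lE bexp0_gt0//.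
  have := expR_ge1Dx (- ((n_ m)%:R * a (xi m))^-1).
  suff : ((n_ m)%:R * a (xi m))^-1 < e by lra.
  rewrite -[ltRHS]invrK ltf_pV2 ?posrE ?invr_gt0//.
  have -> : e^-1 = 2 / (a s * e) * (a s / 2) by field; rewrite !gt_eqF.
  nra.
- have as0 : a s < 0.
    by rewrite subr_lt0 ltNge -(enorm_le _ (ltW r_gt0)) -ltNge.
  apply/cvgrPdist_lt => e e0; near=> m.
  have am : a (xi m) < 0 by near: m; exact: (cvgr_lt (a s)).
  by rewrite /cutoff bexp_le0 ?subr0 ?normr0// lE mulr_ge0_le0// ltW.
Unshelve. all: end_near. Qed.

(** Dominated convergence on the fixed cube [K] with majorant |h|; the exceptional set is the sphere
    at time s, which is null. *)
Lemma cutoff_dct h : L1_loc h -> admissible s -> (forall m, admissible (xi m)) ->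
  (\int[mu]_(w in K) (h w * cutoff (n_ m) (xi m) w))%R @[m --> \oo] -->
  (\int[mu]_(w in flow_ball s) h w)%R.
Proof.
move=> ih as_ axi.
pose f_ m w := (h w * cutoff (n_ m) (xi m) w)%:E.
pose f w := ((h \_ (flow_ball s)) w)%:E.
have mh : measurable_fun [set: 'rV[R]_d] h by case: ih.
have mB : measurable (flow_ball s) by exact: measurable_eball.
have [] := @dominated_convergence _ _ _ mu K mK f_ f (fun w => `|h w|%:E).
- move=> m; apply: measurable_funTS; apply/measurable_EFinP; apply: measurable_funM =>
    //.
  by apply: continuous_measurable_rV; exact: (class_C_continuous (class_C_cutoff c r v z
      0 _ _)).
- apply: measurable_funTS; apply/measurable_EFinP.
  by apply/(measurable_restrictT _ _).1 => //; exact: measurable_funTS.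
- exists [set w | enorm (flow s w - z) = r]; split.
  + by rewrite flow_sphereE//; exact: measurable_esphere.
  + by rewrite flow_sphereE//; apply: mu_esphere; rewrite divr_gt0// admissible_gt0.
  + move=> w /=; apply: contra_notP => /eqP ns _.
    apply: cvg_EFin; first exact: nearW.
    rewrite patchE; have -> : (if w \in flow_ball s then h w else point) =
        h w * (if enorm (flow s w - z) < r then 1 else 0).
      case: ifPn => wB.
        by rewrite ifT ?mulr1//; move: wB; rewrite inE => /(flow_ballP _ as_).
      rewrite ifF ?mulr0//; apply/negP => /(flow_ballP _ as_) => h'.
      by move: wB; rewrite notin_setE.
    apply: cvgM; first exact: cvg_cst.
    exact: cutoff_cvg.
- exact: (integrable_abse (L1_loc_integrable (flow_radius r v z) ih)).
- apply: aeW => w m _; rewrite lee_fin normrM -[leRHS]mulr1 ler_wpM2l//.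
  by rewrite ger0_norm ?cutoff_ge0 ?cutoff_le1.
move=> if_ _ fcvg.
have -> : (\int[mu]_(w in flow_ball s) h w)%R = fine (\int[mu]_(w in K) f w)%E.
  rewrite -{1}(setIidr (flow_ball_sub as_)).
  by rewrite Rintegral_mkcondr.
apply: fine_cvg; rewrite fineK//.
exact: integrable_fin_num.
Qed.

End sequence.

End cutoff_limit.

(** * Time derivative of the smoothed integrals *)

Section cutoff_time_derivative.
Context {R : realType} {d : nat}.
Variables (c r : R) (v z : 'rV[R]_d).
Hypothesis r_gt0 : 0 < r.
Implicit Types (w : 'rV[R]_d) (t : R) (N : nat).
Local Notation mu := (lebesgue_rV R d).
Local Notation K := (@sup_ball R d (flow_radius r v z)).
Local Notation admissible := (admissible c).
Local Notation field := (field c v).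
Local Notation flow := (flow c v).
Local Notation level := (level c r v z).
Local Notation cutoff := (cutoff c r v z).
Local Notation cutoff_dt := (cutoff_dt c r v z).
Local Notation flow_ball := (flow_ball c r v z).

Let mK : measurable K. Proof. exact: measurable_sup_ball. Qed.

Variables (u : 'rV[R]_d -> R) (G : 'rV[R]_d -> 'rV[R]_d).
Hypotheses (iu : L1_loc u) (uG : is_weak_gradient u G).

Let smooth_int N t := (\int[mu]_(w in K) (u w * cutoff N t w))%R.

(** One factor 2 comes from [bexp2_le], the other from differentiating the square; r appears because
    the derivative vanishes unless [flow t w] lies in B(z, r). The bound is uniform in t but not in
    N, so it only justifies differentiation under the integral for a fixed N. *)
Lemma cutoff_dt_le N t w :
  `|cutoff_dt N t w| <= 4 * N%:R * r * enorm (field w).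
Proof.
have RHS0 : 0 <= 4 * N%:R * r * enorm (field w).
  by rewrite !mulr_ge0 ?enorm_ge0// ltW.
rewrite /cutoff_dt.
have [l0|/(level_gt0 r_gt0) l0] := leP (level N t w) 0.
  by rewrite bexp_le0// mul0r normr0.
have N0 : 0 <= N%:R :> R by [].
have h1 : `|dotp (flow t w - z) (field w)| <= r * enorm (field w).
  rewrite ler_norml; apply/andP; split.
    rewrite lerNl -dotpNl (le_trans (ler_dotp _ _))// enormN.
    by rewrite ler_wpM2r ?enorm_ge0// ltW// l0.
  by rewrite (le_trans (ler_dotp _ _))// ler_wpM2r ?enorm_ge0// ltW// l0.
have h2 : `|bexp 2 (level N t w)| <= 2 by rewrite ger0_norm ?bexp_ge0 ?bexp2_le.
rewrite normrM [X in _ * X <= _]normrM.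
have -> : `|- 2 * N%:R| = 2 * N%:R :> R by rewrite mulNr normrN ger0_norm ?mulr_ge0.
rewrite (_ : 4 * _ * _ * _ = 2 * (2 * N%:R * (r * enorm (field w)))); last by ring.
by rewrite ler_pM ?mulr_ge0 ?ler_wpM2l ?mulr_ge0.
Qed.

Lemma is_derive_smooth_int N t : admissible t ->
  is_derive t (1 : R) (smooth_int N) (\int[mu]_(w in K) (u w * cutoff_dt N t w))%R.
Proof.
move=> at_.
pose tau : R := (2 * (1 + `|c|))^-1.
have It : `]-tau, tau[%classic t by rewrite /= in_itv/= -ltr_norml.
have d1 s w : is_derive s (1:R) (fun s => u w * cutoff N s w) (u w * cutoff_dt N s w).
  have H := is_deriveZ (u w) (is_derive_cutoff_time c r v z N s w).
  exact: H.
have d1E s w : partial1of2 (fun s w => u w * cutoff N s w) s w = u w * cutoff_dt N s w.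
  by rewrite partial1of2E; have [] := d1 s w.
have H1 x : `]-tau, tau[%classic x -> mu.-integrable K (EFin \o (fun w =>
    u w * cutoff N x w)).
  move=> _; apply: L1_locM_integrable => //.
  exact: (class_C_continuous (class_C_cutoff c r v z 0 _ _)).
have H2 x w : `]-tau, tau[%classic x -> K w -> derivable (fun s =>
    u w * cutoff N s w) x 1.
  by move=> _ _; have [] := d1 x w.
have H3 w : 0 <= `|u w| * (4 * N%:R * r * enorm (field w)).
  by rewrite mulr_ge0 ?mulr_ge0 ?enorm_ge0// ltW.
have H4 : mu.-integrable K (EFin \o (fun w => `|u w| * (4 * N%:R * r * enorm (field
    w)))).
  rewrite (_ : _ \o _ = (fun w => `|(u w * (4 * N%:R * r * enorm (field w)))%:E|%E));
      last first.
    by apply/funext => w /=; rewrite [in RHS]normrM [X in _ = (_ * X)%:E]ger0_norm//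
        mulr_ge0 ?enorm_ge0// !mulr_ge0// ltW.
  apply: integrable_abse; apply: L1_locM_integrable => //.
  rewrite (_ : (fun w => _) = (cst (4 * N%:R * r) \* (fun w => enorm (field w))))// =>
      w.
  apply: continuousM; first exact: cst_continuous.
  exact: (enorm_continuous (@continuous_field R d c v)).
have H5 x w : `]-tau, tau[%classic x -> K w ->
    `|partial1of2 (fun s w => u w * cutoff N s w) x w| <= `|u w| * (4 * N%:R * r * enorm
        (field w)).
  by move=> _ _; rewrite d1E normrM ler_wpM2l// cutoff_dt_le.
apply: DeriveDef.
  exact: (derivable_under_integral mK It H1 H2 H3 H4 H5).
rewrite -derive1E (differentiation_under_integral mK It H1 H2 H3 H4 H5).
by apply: eq_Rintegral => w _; rewrite -d1E.
Qed.

End cutoff_time_derivative.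

Lemma L1_locP (R : realType) d (f : 'rV[R]_d -> R) :
  measurable_fun [set: 'rV[R]_d] f ->
  (forall rho, (lebesgue_rV R d).-integrable (sup_ball rho) (EFin \o f)) -> L1_loc f.
Proof.
move=> mf h; split => // K cK.
have [M [_ KM]] := compact_bounded cK.
have /integrableP[_] := h (M + 1); apply: le_lt_trans.
apply: ge0_subset_integral.
- rewrite -(setCK K); apply: measurableC; apply: open_measurable_rV.
  by apply: closed_openC; apply: compact_closed => //; exact: norm_hausdorff.
- exact: measurable_sup_ball.
- by apply: measurable_funTS; apply/measurable_EFinP; apply: measurableT_comp.
- by [].
- by move=> w Kw; apply: (KM (M + 1)) => //; rewrite ltrDl.
Qed.

Lemma L1_locM (R : realType) d (u h : 'rV[R]_d -> R) :
  L1_loc u -> continuous h -> L1_loc (fun w => u w * h w).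
Proof.
move=> iu ch; apply: L1_locP => [|rho]; last exact: L1_locM_integrable.
by apply: measurable_funM; [case: iu|exact: continuous_measurable_rV].
Qed.

Lemma L1_loc_enorm (R : realType) d (G : 'rV[R]_d -> 'rV[R]_d) :
  (forall i, L1_loc (fun w => G w 0 i)) -> L1_loc (fun w => enorm (G w)).
Proof.
move=> iG.
have mG : measurable_fun setT G by apply: measurable_fun_rV => i; case: (iG i).
have mn : measurable_fun [set: 'rV[R]_d] (@enorm R d).
  by apply: continuous_measurable_rV; apply: enorm_continuous => w; exact: cvg_id.
have mnG : measurable_fun setT (fun w => enorm (G w)) by exact:
    (measurableT_comp mn mG).
apply: L1_locP => // rho.
apply: (@le_integrable _ _ _ _ _ (measurable_sup_ball rho) _ (fun w =>
    \sum_(i < d) `|(G w 0 i)%:E|)%E).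
- by apply: measurable_funTS; apply/measurable_EFinP.
- move=> w _ /=; rewrite (eq_bigr (fun i => `|G w 0 i|%:E))// sumEFin lee_fin.
  by rewrite (ger0_norm (enorm_ge0 _)) (le_trans (enorm_le_sum _))// ler_norm.
- apply: integrable_sum => [|i _]; first exact: measurable_sup_ball.
  by apply: integrable_abse; exact: L1_loc_integrable.
Qed.

Lemma L1_loc_dotp (R : realType) d (F g : 'rV[R]_d -> 'rV[R]_d) :
  (forall i, L1_loc (fun w => F w 0 i)) -> continuous g ->
  L1_loc (fun w => dotp (F w) (g w)).
Proof.
move=> iF cg.
have cgi i : continuous (fun w => g w 0 i).
  move=> w; apply: (@continuous_comp _ _ _ g (fun y : 'rV[R]_d => y 0 i)); first exact:
      cg.
  exact: coord_continuous.
apply: L1_locP => [|rho].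
  apply: measurable_sum => i; apply: measurable_funM; first by have [] := iF i.
  exact: continuous_measurable_rV.
rewrite (_ : _ \o _ = (fun w => \sum_(i < d) (F w 0 i * g w 0 i)%:E)%E).
  apply: integrable_sum => [|i _]; first exact: measurable_sup_ball.
  by apply: L1_locM_integrable.
by apply/funext => w /=; rewrite sumEFin.
Qed.

(** A mean value theorem for increments of either sign; the bound |xi| <= |s| is the form in which
    admissibility passes to the intermediate point. *)
Lemma MVT0 (R : realType) (f df : R -> R) (s : R) :
  (forall x : R, `|x| <= `|s| -> is_derive x (1 : R) f (df x)) ->
  exists2 xi, `|xi| <= `|s| & f s - f 0 = s * df xi.
Proof.
move=> fd.
have cf a b : (forall x, x \in `[a, b] -> `|x| <= `|s|) ->
    {within `[a, b], continuous f}.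
  move=> h; apply: derivable_within_continuous => x xab.
  by have [] := fd x (h x xab).
have [s0|s0] := leP 0 s.
  have sb x : x \in `[0, s] -> `|x| <= `|s|.
    by rewrite in_itv/= => /andP[x0 xs]; rewrite !ger0_norm.
  have [x xs E] := MVT_segment s0 (fun x xs => fd x (sb x (subset_itv_oo_cc xs))) (cf _
      _ sb).
  by exists x; [exact: sb|rewrite E subr0 mulrC].
have sb x : x \in `[s, 0] -> `|x| <= `|s|.
  by rewrite in_itv/= => /andP[x0 xs]; rewrite !ler0_norm ?lerN2// ltW.
have [x xs E] := MVT_segment (ltW s0) (fun x xs =>
    fd x (sb x (subset_itv_oo_cc xs))) (cf _ _ sb).
exists x; [exact: sb|move: E; rewrite sub0r; lra].
Qed.

(** The errors are measured relative to |s| because the quotient divides them by s; this dictates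
    the accuracy demanded of [n_ m] below. *)
Lemma difference_quotient_le (R : realType) (s q1 q0 j1 j0 D e : R) : s != 0 ->
  `|j1 - q1| <= `|s| * e -> `|j0 - q0| <= `|s| * e -> j1 - j0 = s * D ->
  `|s^-1 * (q1 - q0) - D| <= 2 * e.
Proof.
move=> s0 h1 h0 E; have sm0 : 0 < `|s| by rewrite normr_gt0.
rewrite -(ler_pM2l sm0) -normrM mulrBr mulrA mulfV// mul1r -E.
rewrite (_ : q1 - q0 - _ = (j0 - q0) - (j1 - q1)); last by ring.
rewrite (le_trans (ler_normB _ _))// mulrCA mulr_natl mulr2n.
exact: lerD.
Qed.

Section moving_ball_derivative.
Context {R : realType} {d : nat}.
Variables (c r : R) (v z : 'rV[R]_d).
Hypothesis r_gt0 : 0 < r.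
Local Notation mu := (lebesgue_rV R d).
Local Notation K := (@sup_ball R d (flow_radius r v z)).
Local Notation field := (field c v).
Local Notation cutoff := (cutoff c r v z).
Local Notation cutoff_dt := (cutoff_dt c r v z).
Local Notation flow_ball := (flow_ball c r v z).

Lemma flow_ball0 : flow_ball 0 = eball z r.
Proof. by rewrite /flow_ball mulr0 addr0 invr1 scale1r scale0r subr0 mulr1. Qed.

Variables (u : 'rV[R]_d -> R) (G : 'rV[R]_d -> 'rV[R]_d).
Hypotheses (iu : L1_loc u) (uG : is_weak_gradient u G).

Let J N t := (\int[mu]_(w in K) (u w * cutoff N t w))%R.
Let Q t := (\int[mu]_(w in flow_ball t) u w)%R.

(* Along t_m -> 0, take n_ m so large that the cutoffs of index n_ m have the
   difference quotient of Q up to 2 / m.+1, and rewrite theirs by the mean value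
   theorem. *)
Lemma is_derive_flow_ball : is_derive (0 : R) (1 : R) Q
  (- (\int[mu]_(w in eball z r) dotp (G w) (field w))%R - c * d%:R * (\int[mu]_(w in
      eball z r) u w)%R).
Proof.
set L := (X in is_derive _ _ _ X).
suff H : h^-1 *: (Q (h *: 1 + 0) - Q 0) @[h --> (0 : R)^'] --> L.
  by apply: DeriveDef; [apply/cvg_ex; exists L|exact/cvg_lim].
apply/cvgr_dnbhsP => t [t_neq0 t_cvg0].
(* Only a tail of the sequence is admissible, so the index is shifted by [M] to make every term
   admissible. *)
have [M _ tM] : \forall m \near \oo, admissible c (t m).
  have e0 : 0 < (2 * (1 + `|c|))^-1 by rewrite invr_gt0 mulr_gt0// ltr_pwDl.
  by have /cvgr0_norm_lt/(_ _ e0) := t_cvg0.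
pose s m := t (m + M)%N.
have as_ m : admissible c (s m) by apply: tM => /=; rewrite leq_addl.
have s_neq0 m : s m != 0 by exact: t_neq0.
have s0 : s @ \oo --> (0 : R) by rewrite /s cvg_shiftn.
rewrite -(cvg_shiftn M).
under eq_fun do rewrite [_ *: 1]mulr1 addr0 -/(s _).
have /choice[n_ n_P] : forall m : nat, exists n : nat, (m <= n)%N /\
    (`|J n (s m) - Q (s m)| <= `|s m| / m.+1%:R /\ `|J n 0 - Q 0| <= `|s m| / m.+1%:R).
  move=> m.
  have e0 : 0 < `|s m| / m.+1%:R by rewrite divr_gt0// normr_gt0.
  have a0 := admissible0 c.
  have c_ t' : admissible c t' -> (J n t' @[n --> \oo] --> Q t').
    move=> at'; exact: (@cutoff_dct _ _ c r v z r_gt0 id (fun=> t') t' (fun m =>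
        leqnn m) (@cvg_cst _ t' _ \oo _) u iu at' (fun=> at')).
  have /cvgrPdist_le/(_ _ e0) c1 := c_ _ (as_ m).
  have /cvgrPdist_le/(_ _ e0) c2 := c_ _ a0.
  have [n [[h1 h2] h3]] := filter_ex (filterI (filterI c1 c2) (nbhs_infty_ge m)).
  exists n; split; first exact: h3.
  by split; [move: h1|move: h2]; rewrite /= -normrN opprB.
have /choice[xi xiP] : forall m : nat, exists xi : R, `|xi| <= `|s m| /\
   J (n_ m) (s m) - J (n_ m) 0 = s m * (\int[mu]_(w in K) (u w * cutoff_dt (n_ m) xi
       w))%R.
  move=> m; have [|x x1 x2] := @MVT0 R (J (n_ m)) (fun xi =>
      (\int[mu]_(w in K) (u w * cutoff_dt (n_ m) xi w))%R) (s m).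
    by move=> x xs; apply: is_derive_smooth_int => //; exact: admissible_le xs.
  by exists x.
have axi m : admissible c (xi m) by have [h _] := xiP m; exact: admissible_le h.
have xi0 : xi @ \oo --> (0 : R).
  apply/cvgr0Pnorm_lt => e e0; move/cvgr0Pnorm_lt : s0 => /(_ _ e0).
  by apply: filterS => m; apply: le_lt_trans; have [] := xiP m.
pose D m := (\int[mu]_(w in K) (u w * cutoff_dt (n_ m) (xi m) w))%R.
have le_n m : (m <= n_ m)%N by have [] := n_P m.
have a0 := admissible0 c.
(* The weak gradient identity removes the derivative of the cutoff, and with it the growth in the
   index, so [cutoff_dct] applies along the intermediate times. *)
have DL : D @ \oo --> L.
  have DE m : D m = (1 + c * xi m)^-1 *
     (- (\int[mu]_(w in K) (dotp (G w) (field w) * cutoff (n_ m) (xi m) w))%R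
  - c * d%:R * J (n_ m) (xi m)).
    rewrite /J -(weak_gradient_cutoff v z r_gt0 (n_ m) iu uG (axi m)) mulKf//.
    by rewrite gt_eqF// admissible_gt0.
  rewrite (funext DE).
  have -> : L = 1^-1 * L by rewrite invr1 mul1r.
  apply: cvgM.
    apply: cvgV => //; rewrite -[X in _ --> X]addr0 -(mulr0 c); apply: cvgD;
        first exact: cvg_cst.
    by apply: cvgM => //; exact: cvg_cst.
  rewrite /L -flow_ball0; apply: cvgB.
    apply: cvgN; apply: cutoff_dct => //.
    apply: L1_loc_dotp; first by move=> i; have [] := uG i.
    exact: continuous_field.
  apply: cvgM; first exact: cvg_cst.
  exact: cutoff_dct.
have diff0 : (fun m => (s m)^-1 *: (Q (s m) - Q 0) - D m) @ \oo --> (0 : R).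
  have : (fun m => 2 * m.+1%:R^-1) @ \oo --> (0 : R).
    by rewrite -(mulr0 2); apply: cvgM; [exact: cvg_cst|exact: cvg_harmonic].
  move=> /cvgr0Pnorm_lt h; apply/cvgr0Pnorm_lt => e /h.
  apply: filterS => m; apply: le_lt_trans; rewrite [leRHS]ger0_norm ?mulr_ge0
      ?invr_ge0//.
  have [_ [h1 h2]] := n_P m; have [_ h3] := xiP m.
  exact: (difference_quotient_le (s_neq0 m) h1 h2 h3).
rewrite -[L]add0r.
rewrite (_ : (fun _ => _) = (fun m => ((s m)^-1 *: (Q (s m) - Q 0) - D m) + D m)).
  exact: cvgD.
by apply/funext => m; rewrite subrK.
Qed.

End moving_ball_derivative.

(** * Fractional maximal functions *)

Lemma derive_grad (R : realType) d (h : 'rV[R]_d -> R) x v :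
  differentiable h x -> 'D_v h x = dotp (grad h x) v.
Proof.
move=> dh; rewrite deriveE// {1}(row_sum_delta v) linear_sum.
by apply: eq_bigr => i _; rewrite linearZ mxE /partial_derive deriveE// mulrC.
Qed.

Lemma is_derive_grad (R : realType) d (h : 'rV[R]_d -> R) x v :
  differentiable h x -> is_derive x v h (dotp (grad h x) v).
Proof. by move=> dh; apply: DeriveDef; [exact: diff_derivable|exact: derive_grad]. Qed.

(** The difference quotients along -1/(m+1) and 1/(m+1) are eventually nonpositive and nonnegative
    respectively. *)
Lemma is_derive_local_min (R : realType) (F : R -> R) l :
  is_derive (0 : R) (1 : R) F l -> (\forall h \near (0 : R), F 0 <= F h) -> l = 0.
Proof.
move=> [/cvg_ex[/= l' Fl'] Fl] F0.
have {Fl} ll' : l = l' by rewrite -Fl; exact/cvg_lim.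
have /cvgr_dnbhsP H : h^-1 *: (F (h *: 1 + 0) - F 0) @[h --> (0 : R)^'] --> l.
  by rewrite ll'.
have s0 (k : R) : (fun m => k * m.+1%:R^-1) @ \oo --> (0 : R).
  by rewrite -(mulr0 k); apply: cvgM; [exact: cvg_cst|exact: cvg_harmonic].
have m0 m : 0 < m.+1%:R^-1 :> R by rewrite invr_gt0.
have neq0 (k : R) : k != 0 -> forall m, k * m.+1%:R^-1 != 0.
  by move=> k0 m; rewrite mulf_neq0// gt_eqF.
have N1 : -1 != 0 :> R by rewrite oppr_eq0 oner_eq0.
apply/le_anti/andP; split.
  have := H _ (conj (neq0 _ N1) (s0 (-1))).
  move=> /ler_cvg_to; apply; first exact: cvg_cst.
  near=> m; rewrite [_ *: 1]mulr1 addr0 nmulr_rle0;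
      last by rewrite invr_lt0 mulN1r oppr_lt0.
  by rewrite subr_ge0; near: m; exact: (s0 (-1) _ F0).
have := H _ (conj (neq0 _ (oner_neq0 R)) (s0 1)).
move=> /(ler_cvg_to (cvg_cst 0)); apply.
near=> m; rewrite [_ *: 1]mulr1 addr0; apply: mulr_ge0;
    first by rewrite invr_ge0 mul1r ltW.
by rewrite subr_ge0; near: m; exact: (s0 1 _ F0).
Unshelve. all: end_near. Qed.

Section frac_avg.
Context {R : realType} {d : nat}.
Variables (beta : R) (f : 'rV[R]_d -> R).
Hypothesis f_loc : L1_loc f.
Local Notation mu := (lebesgue_rV R d).
Local Notation V1 := (volume (eball (0 : 'rV[R]_d) 1)).
Implicit Types (x z : 'rV[R]_d) (r : R).

Lemma eball_sup_ball z r : 0 < r -> exists rho, eball z r `<=` sup_ball rho.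
Proof.
move=> r0; exists (flow_radius r 0 z); rewrite -(flow_ball0 0 r 0).
by apply: flow_ball_sub => //; exact: admissible0.
Qed.

Lemma L1_loc_integrable_eball (u : 'rV[R]_d -> R) z r : 0 < r -> L1_loc u ->
  mu.-integrable (eball z r) (EFin \o u).
Proof.
move=> r0 iu; have [rho zrho] := eball_sup_ball z r0.
apply: (integrableS (measurable_sup_ball rho)) => //; first exact: measurable_eball.
exact: L1_loc_integrable.
Qed.

Lemma L1_loc_norm (u : 'rV[R]_d -> R) : L1_loc u -> L1_loc (fun y => `|u y|).
Proof.
move=> [mu_ iu]; split; first exact: measurableT_comp.
by move=> K cK; under eq_integral do rewrite /= normr_id; exact: iu.
Qed.

Lemma frac_avgE z r : 0 < r ->
  frac_avg beta f z r =
  (r `^ beta / volume (eball z r) * (\int[mu]_(y in eball z r) `|f y|)%R)%:E.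
Proof.
move=> r0; rewrite /frac_avg [RHS]EFinM; congr (_ * _)%E.
rewrite fineK//; apply: integrable_fin_num; first exact: measurable_eball.
exact: (L1_loc_integrable_eball z r0 (L1_loc_norm f_loc)).
Qed.

Lemma frac_avg_le_max x r : 0 <= r -> (frac_avg beta f x r <= frac_max beta f x)%E.
Proof. by move=> r0; apply: ereal_sup_ubound; exists r. Qed.

Lemma frac_avg_le_max_nc x z r : eball z r x ->
  (frac_avg beta f z r <= frac_max_nc beta f x)%E.
Proof. by move=> zx; apply: ereal_sup_ubound; exists (z, r). Qed.

Lemma frac_avg_ge0 z r : (0 <= frac_avg beta f z r)%E.
Proof.
rewrite mule_ge0 ?integral_ge0// lee_fin divr_ge0 ?powR_ge0//.
exact: fine_ge0.
Qed.

Lemma frac_max_le_nc x : 0 < beta ->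
  (frac_max beta f x <= frac_max_nc beta f x)%E.
Proof.
move=> b0; apply: ge_ereal_sup => _ [s /= s0 <-].
move: s0; rewrite [(0 <= s)%R]le_eqVlt => /orP[/eqP <-|s0].
  rewrite /frac_avg powR0 ?gt_eqF// mul0r mul0e.
  by rewrite (le_trans (frac_avg_ge0 x 1))// frac_avg_le_max_nc// /eball/= subrr /enorm
      dotp0l sqrtr0.
by rewrite frac_avg_le_max_nc// /eball/= subrr /enorm dotp0l sqrtr0.
Qed.

(* The supremum only runs over open balls containing x: enlarge the ball slightly. *)
Lemma frac_avg_le_max_nc_closed x z r : 0 <= beta -> 0 < r -> closed_eball z r x ->
  (frac_avg beta f z r <= frac_max_nc beta f x)%E.
Proof.
move=> b0 r0 zx.
have [->|Mfin] := eqVneq (frac_max_nc beta f x) +oo%E; first by rewrite leey.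
have {}Mfin : frac_max_nc beta f x \is a fin_num.
  rewrite fin_numE Mfin andbT; apply/eqP => MNy.
  have : (frac_avg beta f x 1 <= frac_max_nc beta f x)%E.
    by rewrite frac_avg_le_max_nc// /eball/= subrr /enorm dotp0l sqrtr0.
  by rewrite MNy leeNy_eq => /eqP e; have := frac_avg_ge0 x 1; rewrite e.
pose M := fine (frac_max_nc beta f x).
pose I := (\int[mu]_(y in eball z r) `|f y|)%R.
have I0 : 0 <= I by apply: Rintegral_ge0.
rewrite -(fineK Mfin) frac_avgE// lee_fin -/M -/I.
(* Passing from radius r to s r increases both the power and the integral; only the volume acts the
   other way, at the cost of a factor s^d, which tends to 1. *)
have h s : 1 < s -> r `^ beta / volume (eball z r) * I <= s ^+ d * M.
  move=> s1; have s0 : 0 < s by rewrite (lt_trans _ s1).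
  have sr0 : 0 < s * r by rewrite mulr_gt0.
  have rsr : r < s * r by rewrite -[ltLHS]mul1r ltr_pM2r.
  have := @frac_avg_le_max_nc x z (s * r) (le_lt_trans zx rsr).
  rewrite frac_avgE// -(fineK Mfin) lee_fin -/M.
  rewrite (volume_eball z r0) (volume_eball z sr0) exprMn.
  have IJ : I <= (\int[mu]_(y in eball z (s * r)) `|f y|)%R.
    rewrite -lee_fin !fineK; last 2 first.
    - apply: integrable_fin_num; first exact: measurable_eball.
      exact: (L1_loc_integrable_eball z sr0 (L1_loc_norm f_loc)).
    - apply: integrable_fin_num; first exact: measurable_eball.
      exact: (L1_loc_integrable_eball z r0 (L1_loc_norm f_loc)).
    apply: ge0_subset_integral => //; [exact: measurable_eball|exact:
        measurable_eball| |].
      apply: measurable_funTS; apply/measurable_EFinP; apply: measurableT_comp => //.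
      by case: f_loc.
    by move=> y /lt_trans; apply.
  have pw : r `^ beta <= (s * r) `^ beta by apply: ge0_ler_powR; rewrite ?nnegrE// ltW.
  move=> le1; have V0 := @volume_eball1_gt0 R d.
  have sd : 0 < s ^+ d by rewrite exprn_gt0.
  rewrite -ler_pdivrMl// (le_trans _ le1)//.
  have rd : 0 < r ^+ d by rewrite exprn_gt0.
  move: (s ^+ d) (r ^+ d) V1 (r `^ beta) ((s * r) `^ beta) (powR_ge0 r beta) sd rd V0 pw
      IJ.
  move=> S T V P P' P0 S0 T0 V0 PP' IJ.
  rewrite [leLHS](_ : _ = P * I / (S * T * V)); last by field; rewrite !gt_eqF.
  have STV : 0 < S * T * V by rewrite !mulr_gt0.
  rewrite [leRHS]mulrAC; apply: ler_wpM2r; first by rewrite invr_ge0 ltW.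
  exact: ler_pM.
pose s k : R := 1 + k.+1%:R^-1.
have s1 : s @ \oo --> (1 : R).
  rewrite -[X in _ --> X]addr0; apply: cvgD; first exact: cvg_cst.
  exact: cvg_harmonic.
have : (fun k => s k ^+ d * M) @ \oo --> 1 ^+ d * M.
  apply: cvgM; last exact: cvg_cst.
  apply: (@cvg_comp _ _ _ s (fun x : R => x ^+ d) _ (nbhs (1 : R))) => //.
  exact: exprn_continuous.
rewrite expr1n mul1r => /(ler_cvg_to (cvg_cst (r `^ beta / volume (eball z r) * I)));
    apply.
by apply: nearW => k; apply: h; rewrite ltrDl invr_gt0.
Qed.

End frac_avg.

(** * Comparison with the average over a moving good ball *)

Section touching.
Context {R : realType} {d : nat}.
Variables (beta : R) (f : 'rV[R]_d -> R) (G : 'rV[R]_d -> 'rV[R]_d).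
Hypotheses (f_loc : L1_loc f) (fG : is_weak_gradient (fun y => `|f y|) G).
Local Notation mu := (lebesgue_rV R d).
Local Notation V1 := (volume (eball (0 : 'rV[R]_d) 1)).

(** The power of the radius rho / (1 + c h) divided by the volume of the ball of that radius:
    [weight] times the integral over [flow_ball] is the fractional average. Its logarithmic
    derivative at 0 is c (d - beta). *)
Let weight (c rho h : R) : R :=
  (rho / (1 + c * h)) `^ beta * (1 + c * h) ^+ d / (rho ^+ d * V1).

Let is_derive_affine (c : R) : is_derive (0 : R) (1 : R) (fun h : R => 1 + c * h) c.
Proof.
have H := is_deriveD (is_derive_cst (1 : R) (0 : R) (1 :
    R)) (is_deriveZ c (is_derive_id (0 : R) (1 : R))).
by apply: (is_derive_eq H); rewrite add0r [LHS]mulr1.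
Qed.

Let is_derive_weight (c rho : R) : 0 < rho ->
  is_derive (0 : R) (1 : R) (weight c rho) (c * (d%:R - beta) * (rho `^ beta / (rho ^+ d
      * V1))).
Proof.
move=> rho0; have a1 := is_derive_affine c.
have n0 : 1 + c * 0 != 0 by rewrite mulr0 addr0 oner_eq0.
have a2 := is_deriveZ rho (@is_deriveV _ (fun h => 1 + c * h) 0 _ _ n0 a1).
have p0 : 0 < rho * (1 + c * 0)^-1 by rewrite mulr0 addr0 invr1 mulr1.
have a3 := @is_derive1_comp _ (fun x => x `^ beta) (fun h =>
    rho * (1 + c * h)^-1) 0 _ _ (is_derive1_powR beta p0) a2.
have a4 := is_deriveX d a1.
have a5 := is_deriveZ (rho ^+ d * V1)^-1 (is_deriveM a3 a4).
rewrite (_ : weight c rho = (rho ^+ d * V1)^-1 \*: (((fun x => x `^ beta) \o (fun h =>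
    rho * (1 + c * h)^-1)) *
         (fun h => 1 + c * h) ^+ d)); last first.
  by apply/funext => h; rewrite /weight !fctE/= [RHS]mulrC.
apply: (is_derive_eq a5).
rewrite /GRing.scale/= !fctE/= mulr0 addr0 invr1 mulr1 !expr1n.
have -> : rho `^ (beta - 1) = rho `^ beta / rho.
  rewrite powRD; last by rewrite (gt_eqF rho0) implybT.
  by rewrite powRN powRr1 ?ltW.
move: (rho `^ beta) => P; field.
by rewrite !gt_eqF ?volume_eball1_gt0 ?exprn_gt0.
Qed.

(** The function [m] and the curve [p] are left abstract so that one argument covers both maximal
    functions and both motions. The summand c d in the derivative of [weight] cancels the one in
    [is_derive_flow_ball], which leaves c beta. *)
Lemma is_derive_touching (c rho D : R) (v z : 'rV[R]_d) (m : 'rV[R]_d -> \bar R) (p :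
    R -> 'rV[R]_d) :
  0 < rho ->
  (\forall h \near (0 : R), m (p h) \is a fin_num) ->
  (\forall h \near (0 : R)%R, frac_avg beta f ((1 + c * h)^-1 *: (z - h *:
      v)) (rho / (1 + c * h)) <= m (p h))%E ->
  m (p 0%R) = frac_avg beta f z rho ->
  is_derive (0 : R) (1 : R) (fun h => fine (m (p h))) D ->
  D = - (c * beta * fine (m (p 0%R)) + rho `^ beta * mean (eball z rho) (fun y =>
      dotp (G y) (c *: y + v))).
Proof.
move=> rho0 mfin mle m0 mD.
pose Q t := (\int[mu]_(w in flow_ball c rho v z t) `|f w|)%R.
have dQ := is_derive_flow_ball c v z rho0 (L1_loc_norm f_loc) fG.
have dA := is_deriveM (is_derive_weight c rho0) dQ.
have avgE h : admissible c h ->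
    frac_avg beta f ((1 + c * h)^-1 *: (z - h *: v)) (rho / (1 + c * h)) = (weight c rho
        h * Q h)%:E.
  move=> ah; have ch := admissible_gt0 ah.
  have rh : 0 < rho / (1 + c * h) by rewrite divr_gt0.
  rewrite frac_avgE// volume_eball//; congr (_ * _)%:E.
  rewrite /weight exprMn exprVn; field.
  by rewrite !gt_eqF ?volume_eball1_gt0 ?exprn_gt0.
have a0 := admissible0 c.
have m0E : fine (m (p 0%R)) = weight c rho 0 * Q 0.
  by rewrite m0 -[LHS]/(fine (frac_avg beta f z rho)); have := avgE _ a0;
    rewrite mulr0 addr0 invr1 mulr1 scale1r scale0r subr0 => ->.
have F0 := is_derive_local_min (is_deriveB mD dA).
have {}F0 := F0 _.
have : D - (weight c rho 0 *: (- (\int[mu]_(w in eball z rho) dotp (G w) (c *: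
    w + v))%R - c * d%:R * (\int[mu]_(w in eball z rho) `|f w|)%R)
   + Q 0 *: (c * (d%:R - beta) * (rho `^ beta / (rho ^+ d * V1)))) = 0.
  apply: F0; near=> h.
  rewrite !fctE m0E subrr subr_ge0 -lee_fin fineK; last by near: h.
  rewrite -avgE; first by near: h.
  near: h; apply/nbhs_ballP; exists (2 * (1 + `|c|))^-1 => /=.
    by rewrite invr_gt0 mulr_gt0// ltr_pwDl.
  by move=> h; rewrite /ball/= sub0r normrN.
rewrite m0E /Q flow_ball0 /mean (volume_eball z rho0) /weight mulr0 addr0 invr1 mulr1
    expr1n mulr1 /GRing.scale/=.
move=> /eqP; rewrite subr_eq0 => /eqP ->.
rewrite /field; set I := (\int[mu]_(w in _) dotp _ _)%R.
by move: I (\int[mu]_(w in eball z rho) `|f w|)%R (rho `^ beta) (_ * V1) => I J P W;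
    ring.
Unshelve. all: end_near. Qed.

End touching.

Lemma continuous_line (R : realType) d (x v : 'rV[R]_d) :
  continuous (fun h : R => h *: v + x).
Proof.
apply: continuous_rV => i; under eq_fun do rewrite !mxE.
move=> h; apply: (@continuousD _ _ _ (fun h : R => h * v 0 i : R) (cst (x 0 i))).
  apply: (@continuousM _ _ id (cst (v 0 i))); first exact: cvg_id.
  exact: cst_continuous.
exact: cst_continuous.
Qed.

Lemma cvg_line (R : realType) d (x v : 'rV[R]_d) (s : R -> R) :
  s @ (0 : R) --> (0 : R) -> (fun h => s h *: v + x) @ (0 : R) --> x.
Proof.
move=> s0; rewrite -[X in _ --> X]add0r -(scale0r v).
apply: (@cvg_comp _ _ _ s (fun h => h *: v + x) _ (nbhs (0 : R))) => //.
exact: continuous_line.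
Qed.

Section gradient_formulas.
Context {R : realType} {d : nat}.
Variables (beta : R) (f : 'rV[R]_d -> R) (G : 'rV[R]_d -> 'rV[R]_d).
Hypotheses (f_loc : L1_loc f) (fG : is_weak_gradient (fun y => `|f y|) G).
Local Notation mu := (lebesgue_rV R d).
Implicit Types (m : 'rV[R]_d -> \bar R) (x z v : 'rV[R]_d) (rho : R).

Lemma is_derive_egrad_line m x v : ediff_at m x ->
  is_derive (0 : R) (1 : R) (fun h => fine (m (h *: v + x))) (dotp (egrad m x) v).
Proof.
by move=> [_ dm]; apply: (is_derive_line (fine \o m) x v _).1; exact: is_derive_grad.
Qed.

Lemma egrad_translation m x v rho : 0 < rho -> ediff_at m x ->
  (forall y, (frac_avg beta f y rho <= m y)%E) -> m x = frac_avg beta f x rho ->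
  dotp (egrad m x) v = rho `^ beta * mean (eball x rho) (fun y => dotp (G y) v).
Proof.
(* The direction is -v because the preimage of the ball under the translation by h v is centred at x
   - h v. *)
move=> rho0 dm mle mx; pose p h := h *: (- v) + x.
have p0 : p 0 = x by rewrite /p scale0r add0r.
have pc : p h @[h --> (0 : R)] --> x.
  by apply: (@cvg_line _ _ _ _ id); exact: cvg_id.
have pE h : p h = (1 + 0 * h)^-1 *: (x - h *: v).
  by rewrite mul0r addr0 invr1 scale1r /p scalerN addrC.
have := @is_derive_touching _ _ beta f G f_loc fG 0 rho (dotp (egrad m x) (- v)) v x m p
    rho0.
rewrite p0 mul0r mul0r add0r dotpNr.
have -> : (fun y => dotp (G y) (0 *: y + v)) = (fun y => dotp (G y) v).
  by apply/funext => y; rewrite scale0r add0r.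
move=> H; apply: oppr_inj; apply: H => //.
- by case: dm => [+ _]; exact: pc.
- by near=> h; rewrite -pE mul0r addr0 invr1 mulr1.
- by rewrite -dotpNr; exact: is_derive_egrad_line.
Unshelve. all: end_near. Qed.

Lemma egrad_dilation m x z rho : 0 < rho -> ediff_at m x ->
  (forall s, 0 < s -> (frac_avg beta f (s *: z)%R (s * rho)%R <= m (s *: x)%R)%E) ->
  m x = frac_avg beta f z rho ->
  dotp (egrad m x) x =
  beta * fine (m x) + rho `^ beta * mean (eball z rho) (fun y => dotp (G y) y).
Proof.
move=> rho0 dm mle mx.
have dinv : is_derive (0 : R) (1 : R) (fun h : R => (1 + h)^-1 - 1) (- 1).
  have H1 := is_deriveD (is_derive_cst (1 : R) (0 : R) (1 : R)) (is_derive_id (0 :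
      R) (1 : R)).
  have n0 : 1 + (0 : R) != 0 by rewrite addr0 oner_eq0.
  have H := is_deriveB (@is_deriveV _ (fun h => 1 + h) 0 _ _ n0 H1) (is_derive_cst (1 :
      R) (0 : R) (1 : R)).
  apply: (is_derive_eq H).
  by rewrite /GRing.scale/= subr0 !addr0 add0r expr1n invr1 mulr1.
(* The point is scaled by the same factor as the ball, which preserves their relative position.
   Writing the curve as x plus a scalar multiple of x gives its derivative by the chain rule along a
   line. *)
pose p h := ((1 + h)^-1 - 1) *: x + x.
have pE h : p h = (1 + h)^-1 *: x by rewrite /p scalerBl scale1r subrK.
have p0 : p 0 = x by rewrite /p addr0 invr1 subrr scale0r add0r.
have pc : p h @[h --> (0 : R)] --> x.
  apply: (@cvg_line _ _ x x (fun h => (1 + h)^-1 - 1)).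
  have [dv _] := dinv; have := differentiable_continuous ((derivable1_diffP _ _).1 dv).
  have e0 : (1 + 0)^-1 - 1 = 0 :> R by rewrite addr0 invr1 subrr.
  by rewrite -[X in _ --> X]e0.
have := @is_derive_touching _ _ beta f G f_loc fG 1 rho (dotp (egrad m x) x * (-1)) 0 z
    m p rho0.
rewrite p0 mul1r mulrN1.
have -> : (fun y => dotp (G y) (1 *: y + 0)) = (fun y => dotp (G y) y).
  by apply/funext => y; rewrite scale1r addr0.
move=> H; apply: oppr_inj; apply: H => //.
- by case: dm => [+ _]; exact: pc.
- near=> h; rewrite mul1r scaler0 subr0 pE [rho / _]mulrC; apply: mle.
  rewrite invr_gt0 -ltrBlDl sub0r; near: h; apply: lt_nbhsr; exact: ltrN10.
- rewrite -mulrN1.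
  apply: (@is_derive1_comp _ (fun s => fine (m (s *: x + x))) (fun h =>
      (1 + h)^-1 - 1)) => //.
  by rewrite addr0 invr1 subrr; exact: is_derive_egrad_line.
Unshelve. all: end_near. Qed.

End gradient_formulas.

(** * Reflections *)

Section reflection.
Context {R : realType} {d : nat}.
Local Notation mu := (lebesgue_rV R d).
Variable v : 'rV[R]_d.

(** Reflection in the hyperplane orthogonal to [v], without normalising [v]. It is a linear
    isometric involution when [v] is nonzero, so the unit ball can serve as the invariant set in
    [lebesgue_rV_involution]. *)
Definition reflection (y : 'rV[R]_d) : 'rV[R]_d :=
  y - (2 * dotp y v / dotp v v) *: v.

Lemma reflectionD : {morph reflection : x y / x + y}.
Proof.
by move=> x y; apply/rowP => i; rewrite /reflection dotpDl !mxE; ring.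
Qed.

Lemma reflectionB : {morph reflection : x y / x - y}.
Proof.
by move=> x y; apply/rowP => i; rewrite /reflection dotpBl !mxE; ring.
Qed.

Lemma reflectionZ a y : reflection (a *: y) = a *: reflection y.
Proof.
by apply/rowP => i; rewrite /reflection dotpZl !mxE; ring.
Qed.

Lemma reflection_orthogonal y : dotp y v = 0 -> reflection y = y.
Proof. by move=> yv; rewrite /reflection yv mulr0 mul0r scale0r subr0. Qed.

Lemma measurable_reflection : measurable_fun setT reflection.
Proof.
apply: measurable_fun_rV => i; under eq_fun do rewrite !mxE.
apply: measurable_funB; first exact: (measurable_coord (f := id)).
apply: measurable_funM => //; apply: measurable_funM => //; apply: measurable_funM =>
    //.
apply: continuous_measurable_rV; apply: dotp_continuous; first by move=> ?; exact:
    cvg_id.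
exact: cst_continuous.
Qed.

Hypothesis v0 : v != 0.

Let vv0 : dotp v v != 0. Proof. by rewrite dotp_eq0. Qed.

Lemma reflection_self : reflection v = - v.
Proof.
rewrite /reflection mulfK//; apply/rowP => i; rewrite !mxE; ring.
Qed.

Lemma dotp_reflection y : dotp (reflection y) v = - dotp y v.
Proof. by rewrite /reflection dotpBl dotpZl divfK//; ring. Qed.

Lemma reflectionK : involutive reflection.
Proof.
move=> y; rewrite {1}/reflection dotp_reflection /reflection.
by apply/rowP => i; rewrite !mxE; ring.
Qed.

Lemma enorm_reflection y : enorm (reflection y) = enorm y.
Proof.
rewrite /enorm; congr Num.sqrt.
by rewrite /reflection !(dotpBl, dotpBr, dotpZl, dotpZr) (dotpC v y); field.
Qed.

Lemma reflection_eball z r : reflection @^-1` (eball (reflection z) r) = eball z r.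
Proof.
by apply/seteqP; split => y; rewrite /eball/= -reflectionB enorm_reflection.
Qed.

Lemma lebesgue_rV_reflection A : measurable A -> mu (reflection @^-1` A) = mu A.
Proof.
move=> mA; apply: (@lebesgue_rV_involution _ _ reflection (eball 0 1)) => //.
- exact: measurable_reflection.
- exact: reflectionD.
- exact: reflectionK.
- exact: measurable_eball.
- by move=> y; rewrite /eball/= !subr0 enorm_reflection.
- by move=> y; rewrite /eball/= !subr0 enormN.
- exact: mu_eball1.
Qed.

Lemma ge0_integral_reflection (g : 'rV[R]_d -> \bar R) A :
  measurable A -> measurable_fun setT g -> (forall y, 0 <= g y)%E ->
  (\int[mu]_(y in A) g y = \int[mu]_(y in reflection @^-1` A) g (reflection y))%E.
Proof.
move=> mA mg g0.
rewrite -(ge0_integral_pushforward measurable_reflection mu mA) //; last first.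
  exact: measurable_funTS.
apply: eq_measure_integral => [|mT B mB _]; first exact: measurable_reflection.
exact: (esym (lebesgue_rV_reflection mB)).
Qed.

Variables (beta : R) (f : 'rV[R]_d -> R).
Hypotheses (mf : measurable_fun setT f) (f_radial : radial f).

Lemma frac_avg_reflection z r :
  frac_avg beta f (reflection z) r = frac_avg beta f z r.
Proof.
rewrite /frac_avg /volume.
have -> : mu (eball (reflection z) r) = mu (eball z r).
  by rewrite -(lebesgue_rV_reflection (measurable_eball _ _)) reflection_eball.
have mef : measurable_fun setT (fun y => `|f y|%:E).
  by apply/measurable_EFinP; exact: measurableT_comp.
suff -> : (\int[mu]_(y in eball (reflection z) r) `|f y|%:E =
           \int[mu]_(y in eball z r) `|f y|%:E)%E by [].
rewrite (ge0_integral_reflection (measurable_eball _ _) mef)// reflection_eball.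
apply: ge0_ae_eq_integral => //.
- exact: measurable_eball.
- apply: measurable_funTS; apply: (measurableT_comp mef); exact: measurable_reflection.
- exact: measurable_funTS.
have [g [N [mN N0 fN]]] := f_radial.
have mTN : measurable (reflection @^-1` N).
  by rewrite -[X in measurable X]setTI; exact: measurable_reflection.
(* [f] has its radial profile only off [N], so both y and its reflection have to avoid [N]. *)
exists (N `|` reflection @^-1` N); split; first exact: measurableU.
- rewrite null_set_setU//; exact: etrans (lebesgue_rV_reflection mN) N0.
- move=> y /= ny; apply: contrapT => /not_orP[nN nTN]; apply: ny => _.
  have fg w : ~ N w -> f w = g (enorm w) by move=> nw; apply: contrapT => /fN.
  by rewrite !fg// enorm_reflection.
Qed.

Lemma frac_max_reflection x : frac_max beta f (reflection x) = frac_max beta f x.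
Proof.
rewrite /frac_max; congr ereal_sup; apply/seteqP; split => _ [r r0 <-]; exists r;
    try exact: r0.
  by rewrite frac_avg_reflection.
by rewrite frac_avg_reflection.
Qed.

End reflection.

(** * Direction of the gradient of the maximal function *)

Section radial_gradient.
Context {R : realType} {d : nat}.
Variables (beta : R) (f : 'rV[R]_d -> R).
Hypotheses (mf : measurable_fun setT f) (f_radial : radial f).

(** The reflection along v fixes x and reverses v, so the maximal function is even along the line x
    + h v and its derivative at h = 0 equals its own opposite. *)
Lemma egrad_orthogonal x v : ediff_at (frac_max beta f) x -> dotp x v = 0 ->
  dotp (egrad (frac_max beta f) x) v = 0.
Proof.
move=> dx xv; have [->|v0] := eqVneq v 0; first by rewrite dotpC dotp0l.
have D1 := is_derive_egrad_line v dx.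
have D2 := is_derive_egrad_line (- v) dx.
have E : (fun h : R => fine (frac_max beta f (h *: (- v) + x))) = (fun h : R =>
    fine (frac_max beta f (h *: v + x))).
  apply/funext => h; rewrite -(frac_max_reflection v0 beta mf f_radial (h *: v + x)).
  suff -> : reflection v (h *: v + x) = h *: (- v) + x by [].
  by rewrite reflectionD reflectionZ (reflection_self v0) (reflection_orthogonal xv).
have [_ e1] := D1; have [_ e2] := D2.
by move: e2; rewrite E e1 dotpNr; lra.
Qed.

(** The component [w] of the gradient orthogonal to x is also orthogonal to the gradient itself, by
    [egrad_orthogonal]; hence it is orthogonal to itself and vanishes. *)
Lemma enorm_egrad x : x != 0 -> ediff_at (frac_max beta f) x ->
  enorm (egrad (frac_max beta f) x) = `|dotp (egrad (frac_max beta f) x) x| / enorm x.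
Proof.
move=> x0 dx; have xx0 : dotp x x != 0 by rewrite dotp_eq0.
set g := egrad _ x.
pose w := g - (dotp g x / dotp x x) *: x.
have xw : dotp x w = 0 by rewrite /w dotpBr dotpZr (dotpC x g) divfK// subrr.
have gw : dotp g w = 0 by exact: egrad_orthogonal.
have : dotp w w = 0 by rewrite {1}/w dotpBl dotpZl xw gw mulr0 subr0.
move=> /eqP; rewrite dotp_eq0 subr_eq0 => /eqP ->.
rewrite enormZ dotpZl divfK// normrM normfV (ger0_norm (dotp_ge0 x)) -sqr_enorm.
by field; rewrite gt_eqF// enorm_gt0.
Qed.

End radial_gradient.

(** * The two inequalities *)

(* [Df] is any representative of the weak gradient of |f|. *)
Theorem lemma4p5 (R : realType) (d : nat) (beta : R)
    (beta_gt0 : 0 < beta) (beta_ltd : beta < d%:R)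
    (f : 'rV[R]_d -> R) (f_W11 : W11_loc f) (f_radial : radial f)
    (Df : 'rV[R]_d -> 'rV[R]_d)
    (Df_grad : is_weak_gradient (fun y => `|f y|) Df)
    (x : 'rV[R]_d) (x_neq0 : x != 0)
    (M_diff : ediff_at (frac_max beta f) x)
    (Mnc_diff : ediff_at (frac_max_nc beta f) x)
    (r : R) (r_good : good_balls beta f x r)
    (z : 'rV[R]_d) (rt : R) (zrt_good : good_balls_nc beta f x (z, rt)) :
  (dotp (egrad (frac_max beta f) x) x <= 0 ->
     enorm (mean_vec (eball x r) Df) <=
     mean (eball x r) (fun y => enorm (Df y) * (enorm y / enorm x)))
  /\
  (0 < dotp (egrad (frac_max beta f) x) x ->
     enorm (egrad (frac_max beta f) x) <=
       r `^ beta * mean (eball x r)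
         (fun y => dotp (Df y) ((enorm x)^-1 *: y))
       - rt `^ beta * mean (eball z rt)
         (fun y => dotp (Df y) ((enorm x)^-1 *: y))
       + dotp (egrad (frac_max_nc beta f) x) ((enorm x)^-1 *: x)).
Proof.
have f_loc : L1_loc f by case: f_W11.
have mf : measurable_fun setT f by case: f_loc.
case: r_good => r0 Mr; case: zrt_good => /= rt0 zx Mz.
have nx0 : 0 < enorm x by rewrite enorm_gt0.
set M := frac_max beta f in M_diff Mr *; set Mn := frac_max_nc beta f in Mnc_diff Mz *.
have Mfin : M x \is a fin_num by case: M_diff => /nbhs_singleton.
have Mnfin : Mn x \is a fin_num by case: Mnc_diff => /nbhs_singleton.
have M0 : 0 <= fine (M x) by rewrite fine_ge0// Mr frac_avg_ge0.
have MMn : fine (M x) <= fine (Mn x) by rewrite fine_le// frac_max_le_nc.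
have gx : dotp (egrad M x) x =
    beta * fine (M x) + r `^ beta * mean (eball x r) (fun y => dotp (Df y) y).
  apply: (egrad_dilation f_loc Df_grad r0 M_diff) => // s s0.
  by rewrite frac_avg_le_max// mulr_ge0// ltW.
have gnx : dotp (egrad Mn x) x =
    beta * fine (Mn x) + rt `^ beta * mean (eball z rt) (fun y => dotp (Df y) y).
  apply: (egrad_dilation f_loc Df_grad rt0 Mnc_diff) => // s s0.
  (* The good ball is only known to contain x in its closure, a property that scaling preserves. *)
  apply: frac_avg_le_max_nc_closed => //; [exact: ltW|exact: mulr_gt0|].
  by rewrite /closed_eball/= -scalerBr enormZ gtr0_norm// ler_pM2l.
have gv v : dotp (egrad M x) v = r `^ beta * mean (eball x r) (fun y => dotp (Df y) v).
  apply: (egrad_translation f_loc Df_grad) => // y.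
  by rewrite frac_avg_le_max// ltW.
have gE := enorm_egrad mf f_radial x_neq0 M_diff.
have iDf i : L1_loc (fun y => Df y 0 i) by case: (Df_grad i).
have idot : L1_loc (fun y => dotp (Df y) y).
  by apply: L1_loc_dotp => // y; exact: cvg_id.
have meanZ z' rho k : 0 < rho -> mean (eball z' rho) (fun y => dotp (Df y) (k *: y)) =
    k * mean (eball z' rho) (fun y => dotp (Df y) y).
  move=> rho0; rewrite /mean mulrCA; congr (_ * _).
  rewrite -(RintegralZl _ (measurable_eball _ _) (L1_loc_integrable_eball z' rho0
      idot)).
  by apply: eq_Rintegral => y _; rewrite dotpZr.
split=> [gx0|gx0].
  have pr0 : 0 < r `^ beta by rewrite powR_gt0.
  (* The translation formula on the basis vectors turns the left side into the norm of the gradient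
     of M, which the dilation formula then evaluates. *)
  have -> : mean_vec (eball x r) Df = (r `^ beta)^-1 *: egrad M x.
    apply/rowP => i; rewrite !mxE.
    have := gv (delta_mx 0 i); rewrite dotp_delta /egrad mxE => ->.
    rewrite mulKf ?gt_eqF//; congr (_ * _); apply: eq_Rintegral => y _.
    by rewrite dotp_delta.
  rewrite enormZ gtr0_norm ?invr_gt0// gE ler0_norm// gx.
  apply: (@le_trans _ _ (- (enorm x)^-1 * mean (eball x r) (fun y => dotp (Df y) y))).
    move: (mean _ _) (r `^ beta) pr0 => I P P0; rewrite -subr_ge0.
    rewrite (_ : _ - _ = P^-1 * (beta * fine (M x)) / enorm x).
      by rewrite divr_ge0 ?mulr_ge0 ?invr_ge0 ?(ltW P0) ?(ltW beta_gt0) ?(ltW nx0).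
    by field; rewrite !gt_eqF.
  rewrite -meanZ//; apply: ler_wpM2l; first by rewrite invr_ge0 fine_ge0.
  apply: le_Rintegral; first exact: measurable_eball.
  - apply: L1_loc_integrable_eball => //; apply: L1_loc_dotp => //.
    apply: continuous_rV => i; under eq_fun do rewrite mxE.
    move=> y; apply: (@continuousM _ _ (cst (- (enorm x)^-1)) (fun y : 'rV[R]_d =>
        y 0 i)).
      exact: cst_continuous.
    exact: coord_continuous.
  - apply: L1_loc_integrable_eball => //; apply: L1_locM; first exact: L1_loc_enorm.
    move=> y; apply: (@continuousM _ _ (@enorm R d) (cst (enorm x)^-1)); last exact:
        cst_continuous.
    by apply: enorm_continuous => w; exact: cvg_id.
  - move=> y _; rewrite dotpZr mulNr -mulrN -dotpNl mulrA mulrC.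
    rewrite ler_wpM2r ?invr_ge0 ?enorm_ge0//.
    by rewrite (le_trans (ler_dotp _ _))// enormN.
rewrite !meanZ// dotpZr gnx gE gtr0_norm// gx.
move: (mean _ _) (mean _ _) (r `^ beta) (rt `^ beta) => I It P Pt.
(* Both means cancel against the two dilation formulas, so the gap between the two sides is exactly
   this multiple of the difference of the maximal functions. *)
rewrite -subr_ge0 (_ : _ - _ = beta * (fine (Mn x) - fine (M x)) / enorm x).
  by rewrite divr_ge0 ?mulr_ge0 ?subr_ge0 ?(ltW beta_gt0) ?(ltW nx0).
by field; rewrite gt_eqF.
Qed.
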